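(* Let $\alpha$, $\theta$ be nonconstant inner functions such that $\alpha$ divides $\theta$. Let $\varphi\in L^2$ and let $A_\varphi^{\theta,\alpha}\colon K^2_\theta \to K^2_\alpha$ be a bounded asymmetric truncated Toeplitz operator. Then $A_\varphi^{\theta,\alpha}=0$ if and only if $\varphi\in \alpha H^2 +\overline{\theta H^2}$.
   Context: $L^2=L^2(\mathbb T,m)$ with $\mathbb T$ the unit circle and $m$ normalized Lebesgue measure; $H^2\subset L^2$ is the Hardy space of the unit disc (identified with boundary values). For an inner function $u$, $K^2_u=H^2\ominus uH^2$ is the model space and $P_u\colon L^2\to K^2_u$ is the orthogonal projection. $\alpha$ divides $\theta$ means that $\theta/\alpha=\bar\alpha\theta$ is an inner function. $\overline{\theta H^2}=\{\overline{\theta h}: h\in H^2\}$. For $\varphi\in L^2$, the asymmetric truncated Toeplitz operator $A_\varphi^{\theta,\alpha}$ is $A_\varphi^{\theta,\alpha}f=P_\alpha(\varphi f)$ with domain $\{f\in K^2_\theta:\varphi f\in L^2\}$, which contains the dense subspace $K^2_\theta\cap H^\infty$; if it is bounded, $A_\varphi^{\theta,\alpha}$ also denotes its unique bounded extension $K^2_\theta\to K^2_\alpha$. *)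

(* Defs.v *)
From HB Require Import structures.
From mathcomp Require Import all_boot all_order all_algebra.
From mathcomp Require Import complex.
From mathcomp Require Import all_classical all_reals all_analysis.

Set Implicit Arguments.
Unset Strict Implicit.
Unset Printing Implicit Defensive.
Import Order.TTheory GRing.Theory Num.Theory numFieldNormedType.Exports.

Local Open Scope classical_set_scope.
Local Open Scope ring_scope.
Local Open Scope complex_scope.

Definition circle (R : realType) : Type := {z : R[i] | `|z| == 1}.

HB.instance Definition _ (R : realType) := SubChoice.on (circle R).

Lemma circle_param_subproof (R : realType) (t : R) :
  `|cos (2 * pi * t) +i* sin (2 * pi * t)| == 1.
Proof. by rewrite normc_def /= cos2Dsin2 sqrtr1. Qed.

Definition circle_param (R : realType) (t : R) : circle R :=
  exist _ (cos (2 * pi * t) +i* sin (2 * pi * t)) (circle_param_subproof t).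

HB.instance Definition _ (R : realType) :=
  isPointed.Build (circle R) (circle_param 0).

(* The Borel sets of the circle: since [circle_param] is continuous, periodic
   and restricts to a Borel isomorphism from [0, 1[ onto the circle, A is Borel
   iff its preimage in R is. *)
Definition circle_measurable (R : realType) : set (set (circle R)) :=
  image_set_system setT (@circle_param R) measurable.

Section circle_sigma_algebra.
Variable R : realType.

Let sa : sigma_algebra setT (@circle_measurable R) :=
  sigma_algebra_image (@circle_param R)
    (@sigma_algebra_measurable _ (measurableTypeR R)).

Let circle_measurable0 : circle_measurable (set0 : set (circle R)).
Proof. by case: sa. Qed.

Let circle_measurableC (A : set (circle R)) :
  circle_measurable A -> circle_measurable (~` A).
Proof. by case: sa => _ + _ => /[apply]; rewrite setTD. Qed.

Let circle_measurable_bigcup (F : (set (circle R))^nat) :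
  (forall i, circle_measurable (F i)) -> circle_measurable (\bigcup_i F i).
Proof. by case: sa => _ _; exact. Qed.

HB.instance Definition _ := isMeasurable.Build default_measure_display
  (circle R) circle_measurable0 circle_measurableC circle_measurable_bigcup.

End circle_sigma_algebra.

Lemma measurable_circle_param (R : realType) :
  @measurable_fun _ _ (measurableTypeR R) (circle R) setT (@circle_param R).
Proof. by []. Qed.

Definition circle_mfun (R : realType) : {mfun measurableTypeR R >-> circle R} :=
  HB.pack (@circle_param R)
    (@isMeasurableFun.Build _ _ (measurableTypeR R) (circle R) (@circle_param R)
      (@measurable_circle_param R)).

(* Normalized Lebesgue measure: the law of exp(2 i pi t), t uniform on [0, 1]. *)
Definition circle_measure (R : realType) : probability (circle R) R :=
  distribution (uniform_prob (@ltr01 R)) (circle_mfun R).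

Section hardy.
Variable R : realType.
Local Notation C := R[i].
Local Notation T := (circle R).
Local Notation m := (circle_measure R).

(* Elements of L^2 are represented by Borel functions on the circle; equality
   in L^2 is [eq_ae]. *)
Definition eq_ae (f g : T -> C) : Prop := {ae m, forall z : T, f z = g z}.

Definition norm2 (f : T -> C) : \bar R :=
  'N[m]_2%:E[(fun z => (Normc.normc (f z))%:E)]%E.

Definition L2 (f : T -> C) : Prop :=
  [/\ measurable_fun setT (fun z => complex.Re (f z)),
      measurable_fun setT (fun z => complex.Im (f z)) &
      (norm2 f < +oo)%E].

Definition inner (f g : T -> C) : C :=
  let p z := f z * (g z)^* in
  (\int[m]_z complex.Re (p z))%R +i* (\int[m]_z complex.Im (p z))%R.

(* Analyticity on the open unit disc, as convergence of a power series centred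
   at 0; the values of F outside the disc are irrelevant. The regular module
   C^o carries the norm topology of C. *)
Definition disc_analytic (F : C -> C) : Prop :=
  exists a : nat -> C, forall z : C, `|z| < 1 ->
    series (fun n => a n * z ^+ n : C^o) @ \oo --> (F z : C^o).

Definition dilate (F : C -> C) (r : R) : T -> C := fun z => F (r%:C * \val z).

(* f is the L^2-limit of the dilates F(r .) as r tends to 1 from below. *)
Definition boundary_value (F : C -> C) (f : T -> C) : Prop :=
  L2 f /\ norm2 (fun z => dilate F r z - f z) @[r --> 1^'-] --> 0%E.

(* The Hardy space of the disc, identified with its boundary values in L^2. *)
Definition H2 (f : T -> C) : Prop :=
  exists F : C -> C, [/\ disc_analytic F,
    exists M : R, forall r : R, 0 <= r < 1 -> (norm2 (dilate F r) <= M%:E)%E &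
    boundary_value F f].

Definition Hoo (f : T -> C) : Prop :=
  exists F : C -> C, [/\ disc_analytic F,
    exists M : C, forall z : C, `|z| < 1 -> `|F z| <= M &
    boundary_value F f].

Definition inner_function (u : T -> C) : Prop :=
  Hoo u /\ {ae m, forall z : T, `|u z| = 1}.

Definition nonconstant (u : T -> C) : Prop := forall c : C, ~ eq_ae u (cst c).

Definition inner_divides (alpha theta : T -> C) : Prop :=
  inner_function (fun z => (alpha z)^* * theta z).

Definition model_space (u : T -> C) (f : T -> C) : Prop :=
  H2 f /\ forall h : T -> C, H2 h -> inner f (fun z => u z * h z) = 0.

(* [orth_proj V f g]: g is the orthogonal projection of f onto V. *)
Definition orth_proj (V : (T -> C) -> Prop) (f g : T -> C) : Prop :=
  V g /\ forall h : T -> C, V h -> inner (fun z => f z - g z) h = 0.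

Definition bounded_operator (V W : (T -> C) -> Prop)
    (A : (T -> C) -> (T -> C)) : Prop :=
  [/\ forall f, V f -> W (A f),
      forall (c : C) f g, V f -> V g ->
        eq_ae (A (fun z => c * f z + g z)) (fun z => c * A f z + A g z) &
      exists M : R, forall f, V f -> (norm2 (A f) <= M%:E * norm2 f)%E].

(* [A] is the bounded extension to K^2_theta of f |-> P_alpha (phi f), which is
   defined a priori on {f in K^2_theta | phi f in L^2}. This domain is dense, so
   that [A], when it exists, is unique up to almost everywhere equality. *)
Definition bounded_atto (theta alpha phi : T -> C)
    (A : (T -> C) -> (T -> C)) : Prop :=
  bounded_operator (model_space theta) (model_space alpha) A /\
  forall f, model_space theta f -> L2 (fun z => phi z * f z) ->
    orth_proj (model_space alpha) (fun z => phi z * f z) (A f).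

End hardy.

(* Main.v *)
Require Import Defs.
From mathcomp Require Import all_boot all_order all_algebra.
From mathcomp Require Import complex.
From mathcomp Require Import all_classical all_reals all_analysis.
From mathcomp Require Import measurable_realfun zify ring lra.

Set Implicit Arguments.
Unset Strict Implicit.
Unset Printing Implicit Defensive.
Import Order.TTheory GRing.Theory Num.Theory numFieldNormedType.Exports.

Local Open Scope classical_set_scope.
Local Open Scope complex_scope.
Local Open Scope ring_scope.

(** Write P_u for the projection onto K_u = H^2 - u H^2 (orthogonal difference)
    and a for the mean of an inner function u over the circle.

    If phi = alpha h + conj(theta k) and f in K_theta is bounded, then
    alpha h f is in alpha H^2, and conj(theta k) f is orthogonal to H^2 because f
    is orthogonal to theta H^2. Both are orthogonal to K_alpha, so that A f = 0
    (atto_bounded_eq0). The projections onto K_theta of trigonometric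
    polynomials are bounded, because P_theta z^n = z^n - theta q with q a
    polynomial (model_proj); they are dense in K_theta, and A is bounded, so that
    A = 0 on all of K_theta.

    Conversely, A = 0 means that phi f is orthogonal to K_alpha for each bounded f
    in K_theta, that is, phi f is in alpha H^2 + conj(z H^2)
    (orth_bounded_model_space). Two such f are P_u 1 = 1 - conj(a) u and the
    backward shift S^* u = conj(z) (u - a), for u = theta, and
    P_u 1 + conj(a) z S^* u = 1 - |a|^2 is a nonzero constant because u is
    not constant. Hence phi is in alpha H^2 + conj(H^2)
    (symbol_decomposition). The same argument for the adjoint, with
    conj(phi) on K_alpha, puts phi in H^2 + conj(theta H^2). Subtracting the two
    representations yields a function that lies in H^2 together with its
    conjugate, that is, a constant c, and phi is in alpha H^2 + conj(theta H^2)
    up to c. As alpha divides theta, P_alpha 1 is in both model spaces, and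
    testing A on it gives c = 0 (vanishing_form_symbol).

    All of this takes place on the Fourier side, where H^2 is the space of the
    functions of L^2 without coefficient of negative index. The identification
    with boundary values of analytic functions (H2_hardy) rests on two facts.
    A function of L^2 is determined by its Fourier coefficients
    (fourier_unique): polynomials in a trigonometric polynomial of degree
    one converge boundedly to indicator functions of arcs, so that a function
    without Fourier coefficients has a vanishing primitive. And square summable
    sequences are Fourier coefficients (riesz_fischer). *)

(** * Integration of complex-valued functions *)

Section squared_modulus.
Variable R : realType.
Implicit Types w v : R[i].

Definition abs2 w : R := complex.Re w ^+ 2 + complex.Im w ^+ 2.

Lemma cReD w v : complex.Re (w + v) = complex.Re w + complex.Re v.
Proof. by case: w v => a b [c e]. Qed.

Lemma cImD w v : complex.Im (w + v) = complex.Im w + complex.Im v.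
Proof. by case: w v => a b [c e]. Qed.

Lemma cReM w v : complex.Re (w * v) =
  complex.Re w * complex.Re v - complex.Im w * complex.Im v.
Proof. by case: w v => a b [c e]. Qed.

Lemma cImM w v : complex.Im (w * v) =
  complex.Re w * complex.Im v + complex.Im w * complex.Re v.
Proof. by case: w v => a b [c e]. Qed.

Lemma cRe_conj w : complex.Re w^* = complex.Re w. Proof. by case: w. Qed.

Lemma cIm_conj w : complex.Im w^* = - complex.Im w. Proof. by case: w. Qed.

Lemma cReN w : complex.Re (- w) = - complex.Re w. Proof. by case: w. Qed.

Lemma cImN w : complex.Im (- w) = - complex.Im w. Proof. by case: w. Qed.

Lemma complex_eqP w v :
  complex.Re w = complex.Re v -> complex.Im w = complex.Im v -> w = v.
Proof. by case: w v => a b [c e] /= -> ->. Qed.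

Lemma abs2_ge0 w : 0 <= abs2 w.
Proof. by rewrite addr_ge0// sqr_ge0. Qed.

Lemma abs2M w v : abs2 (w * v) = abs2 w * abs2 v.
Proof. by rewrite /abs2 cReM cImM; ring. Qed.

Lemma abs2X w n : abs2 (w ^+ n) = abs2 w ^+ n.
Proof.
elim: n => [|n IH]; first by rewrite !expr0 /abs2/= expr1n expr0n addr0.
by rewrite !exprS abs2M IH.
Qed.

Lemma abs2_conj w : abs2 w^* = abs2 w.
Proof. by rewrite /abs2 cRe_conj cIm_conj sqrrN. Qed.

Lemma abs2N w : abs2 (- w) = abs2 w.
Proof. by case: w => a b; rewrite /abs2/= !sqrrN. Qed.

Lemma abs2_real (x : R) : abs2 x%:C = x ^+ 2.
Proof. by rewrite /abs2/= expr0n addr0. Qed.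

Lemma abs20 : abs2 0 = 0.
Proof. by rewrite /abs2/= expr0n addr0. Qed.

Lemma abs2_eq0 w : abs2 w = 0 -> w = 0.
Proof.
move=> /eqP; rewrite paddr_eq0 ?sqr_ge0// !sqrf_eq0 => /andP[/eqP ? /eqP ?].
exact: complex_eqP.
Qed.

Lemma abs2_normc w : abs2 w = Normc.normc w ^+ 2.
Proof. by case: w => a b; rewrite sqr_sqrtr// addr_ge0// sqr_ge0. Qed.

Lemma abs2E w : (abs2 w)%:C = w * w^*.
Proof. by apply: complex_eqP; rewrite ?(cReM, cImM, cRe_conj, cIm_conj)/= /abs2; ring. Qed.

Lemma norm_complexE w : `|w| = (Num.sqrt (abs2 w))%:C.
Proof. by case: w. Qed.

Lemma abs2D_le w v : abs2 (w + v) <= 2 * abs2 w + 2 * abs2 v.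
Proof.
rewrite /abs2 cReD cImD.
have := sqr_ge0 (complex.Re w - complex.Re v).
have := sqr_ge0 (complex.Im w - complex.Im v).
nra.
Qed.

End squared_modulus.

Section complex_integral.
Context d (X : measurableType d) (R : realType).
Variable mu : {measure set X -> \bar R}.
Implicit Types f g : X -> R[i].

Definition cmeasurable f :=
  measurable_fun setT (fun x => complex.Re (f x)) /\
  measurable_fun setT (fun x => complex.Im (f x)).

Definition cintegrable f :=
  mu.-integrable setT (fun x => (complex.Re (f x))%:E) /\
  mu.-integrable setT (fun x => (complex.Im (f x))%:E).

Definition cint f : R[i] :=
  ((\int[mu]_x complex.Re (f x))%R +i* (\int[mu]_x complex.Im (f x))%R)%C.

Lemma cmeasurable_cst (c : R[i]) : cmeasurable (fun=> c).
Proof. by split; exact: measurable_cst. Qed.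

Lemma cmeasurableD f g : cmeasurable f -> cmeasurable g ->
  cmeasurable (fun x => f x + g x).
Proof.
move=> [f1 f2] [g1 g2]; split.
  by under eq_fun do rewrite cReD; exact: measurable_funD.
by under eq_fun do rewrite cImD; exact: measurable_funD.
Qed.

Lemma cmeasurableM f g : cmeasurable f -> cmeasurable g ->
  cmeasurable (fun x => f x * g x).
Proof.
move=> [f1 f2] [g1 g2]; split.
  under eq_fun do rewrite cReM; apply: measurable_funB; exact: measurable_funM.
under eq_fun do rewrite cImM; apply: measurable_funD; exact: measurable_funM.
Qed.

Lemma cmeasurable_conj f : cmeasurable f -> cmeasurable (fun x => (f x)^*).
Proof.
move=> [f1 f2]; split; first by under eq_fun do rewrite cRe_conj.
under eq_fun do rewrite cIm_conj; exact: measurableT_comp.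
Qed.

Lemma cmeasurableX f n : cmeasurable f -> cmeasurable (fun x => f x ^+ n).
Proof.
move=> mf; elim: n => [|n IH]; first exact: cmeasurable_cst.
by under eq_fun do rewrite exprS; exact: cmeasurableM.
Qed.

Lemma measurable_abs2 f : cmeasurable f ->
  measurable_fun setT (fun x => abs2 (f x)).
Proof.
by move=> [f1 f2]; apply: measurable_funD; exact: measurable_funX.
Qed.

Lemma ae_le_integrable (f g : X -> R) :
  measurable_fun setT f -> mu.-integrable setT (EFin \o g) ->
  {ae mu, forall x, `|f x| <= g x} -> mu.-integrable setT (EFin \o f).
Proof.
move=> mf /integrableP[mg goo] fg; apply/integrableP; split.
  exact/measurable_EFinP.
apply: le_lt_trans goo; apply: ae_ge0_le_integral => //.
- by apply: measurableT_comp => //; exact/measurable_EFinP.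
- exact: measurableT_comp.
- apply: filterS fg => x fgx _ /=.
  by rewrite lee_fin (le_trans fgx)// ler_norm.
Qed.

Lemma cintD f g : cintegrable f -> cintegrable g ->
  cint (fun x => f x + g x) = cint f + cint g.
Proof.
move=> [f1 f2] [g1 g2]; apply: complex_eqP; rewrite ?cReD ?cImD /=.
  by rewrite -RintegralD//; congr Rintegral; apply/funext => x; rewrite cReD.
by rewrite -RintegralD//; congr Rintegral; apply/funext => x; rewrite cImD.
Qed.

Lemma cintZ c f : cintegrable f -> cint (fun x => c * f x) = c * cint f.
Proof.
move=> [f1 f2].
have i1 (r : R) : mu.-integrable setT (fun x => (r * complex.Re (f x))%:E).
  by under eq_fun do rewrite EFinM; exact: integrableZl.
have i2 (r : R) : mu.-integrable setT (fun x => (r * complex.Im (f x))%:E).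
  by under eq_fun do rewrite EFinM; exact: integrableZl.
apply: complex_eqP; rewrite ?cReM ?cImM /= -!RintegralZl//.
  rewrite -(RintegralB _ (i1 _) (i2 _))//.
  by congr Rintegral; apply/funext => x; rewrite cReM.
rewrite -(RintegralD _ (i2 _) (i1 _))//.
by congr Rintegral; apply/funext => x; rewrite cImM.
Qed.

Lemma cint_conj f : cintegrable f -> cint (fun x => (f x)^*) = (cint f)^*.
Proof.
move=> [f1 f2]; apply: complex_eqP => /=.
  by congr Rintegral; apply/funext => x; rewrite cRe_conj.
rewrite -mulN1r -RintegralZl//; apply: eq_Rintegral => x _.
by rewrite cIm_conj mulN1r.
Qed.

Lemma ae_eq_cint f g : cmeasurable f -> cmeasurable g ->
  {ae mu, forall x, f x = g x} -> cint f = cint g.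
Proof.
move=> [f1 f2] [g1 g2] fg; apply: complex_eqP => /=; congr fine;
  apply: ae_eq_integral => //; try exact/measurable_EFinP;
  by apply: filterS fg => x -> _.
Qed.

Lemma eq_cint f g : f =1 g -> cint f = cint g.
Proof. by move=> /funext ->. Qed.

End complex_integral.

(** * The space L^2 of the circle *)

Section L2_circle.
Variable R : realType.
Local Notation C := R[i].
Local Notation T := (circle R).
Local Notation m := (circle_measure R).
Implicit Types (f g h u : T -> C) (c : C).

Definition nsq f : R := (\int[m]_z abs2 (f z))%R.

Definition ae_bounded f := exists B : R, {ae m, forall z, abs2 (f z) <= B}.

Lemma norm2_int f : norm2 f = ((\int[m]_z (abs2 (f z))%:E) `^ 2^-1)%E.
Proof.
rewrite /norm2 unlock; congr (_ `^ _)%E; apply: eq_integral => z _ /=.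
by rewrite powR_mulrn// abs2_normc real_normK ?num_real.
Qed.

Lemma L2P f : L2 f <->
  cmeasurable f /\ m.-integrable setT (fun z => (abs2 (f z))%:E).
Proof.
split=> [[f1 f2 foo]|[[f1 f2] /integrableP[mf foo]]].
  have mf : measurable_fun setT (fun z => abs2 (f z)) by exact: measurable_abs2.
  split; first by split.
  apply/integrableP; split; first exact/measurable_EFinP.
  under eq_integral do rewrite gee0_abs ?lee_fin ?abs2_ge0//.
  move: foo; rewrite norm2_int; apply: contraPP => /negP; rewrite -leNgt leye_eq => /eqP ->.
  by rewrite eqy_poweR ?invr_gt0.
split=> //; rewrite norm2_int; apply: poweR_lty.
by move: foo; under eq_integral do rewrite gee0_abs ?lee_fin ?abs2_ge0//.
Qed.

Lemma L2_cmeasurable f : L2 f -> cmeasurable f.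
Proof. by case/L2P. Qed.

Lemma integrable_abs2 f : L2 f -> m.-integrable setT (fun z => (abs2 (f z))%:E).
Proof. by case/L2P. Qed.

Lemma nsq_ge0 f : 0 <= nsq f.
Proof. by apply: Rintegral_ge0 => z _; exact: abs2_ge0. Qed.

Lemma EFin_nsq f : L2 f -> (nsq f)%:E = (\int[m]_z (abs2 (f z))%:E)%E.
Proof. by move=> /integrable_abs2 fi; rewrite fineK// integrable_fin_num. Qed.

Lemma norm2E f : L2 f -> norm2 f = (Num.sqrt (nsq f))%:E.
Proof.
by move=> Lf; rewrite norm2_int -EFin_nsq// poweR_EFin -powR12_sqrt ?nsq_ge0.
Qed.

Lemma L2_dominated f (g : T -> R) : cmeasurable f ->
  m.-integrable setT (fun z => (g z)%:E) ->
  {ae m, forall z, abs2 (f z) <= g z} -> L2 f.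
Proof.
move=> mf gi fg; apply/L2P; split=> //.
apply: (@ae_le_integrable _ _ _ _ (fun z => abs2 (f z)) g) => //.
  exact: measurable_abs2.
by apply: filterS fg => z fgz; rewrite ger0_norm ?abs2_ge0.
Qed.

Lemma L2D f g : L2 f -> L2 g -> L2 (fun z => f z + g z).
Proof.
move=> /L2P[mf fi] /L2P[mg gi].
apply: (@L2_dominated _ (fun z => 2 * abs2 (f z) + 2 * abs2 (g z))).
- exact: cmeasurableD.
- under eq_fun do rewrite EFinD !EFinM.
  by apply: integrableD => //; exact: integrableZl.
- by apply: aeW => z; exact: abs2D_le.
Qed.

Lemma L2_bounded f : cmeasurable f -> ae_bounded f -> L2 f.
Proof.
move=> mf [B fB]; apply: (@L2_dominated _ (fun=> B)) => //.
exact: finite_measure_integrable_cst.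
Qed.

Lemma L2_cst c : L2 (fun=> c).
Proof.
apply: L2_bounded; first exact: cmeasurable_cst.
by exists (abs2 c); apply: aeW.
Qed.

Lemma L2M u f : cmeasurable u -> ae_bounded u -> L2 f -> L2 (fun z => u z * f z).
Proof.
move=> mu [B uB] /L2P[mf fi].
apply: (@L2_dominated _ (fun z => B * abs2 (f z))).
- exact: cmeasurableM.
- by under eq_fun do rewrite EFinM; exact: integrableZl.
- by apply: filterS uB => z uz; rewrite abs2M ler_wpM2r ?abs2_ge0.
Qed.

Lemma L2Z c f : L2 f -> L2 (fun z => c * f z).
Proof.
apply: L2M; first exact: cmeasurable_cst.
by exists (abs2 c); apply: aeW.
Qed.

Lemma L2N f : L2 f -> L2 (fun z => - f z).
Proof. by move=> /(L2Z (-1)); under eq_fun do rewrite mulN1r. Qed.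

Lemma L2B f g : L2 f -> L2 g -> L2 (fun z => f z - g z).
Proof. by move=> Lf Lg; apply: L2D => //; exact: L2N. Qed.

Lemma L2_conj f : L2 f -> L2 (fun z => (f z)^*).
Proof.
move=> /L2P[mf fi]; apply/L2P; split; first exact: cmeasurable_conj.
by under eq_fun do rewrite abs2_conj.
Qed.

Lemma L2_sum n (F : nat -> T -> C) : (forall i, L2 (F i)) ->
  L2 (fun z => \sum_(i < n) F i z).
Proof.
move=> LF; elim: n => [|n IH].
  by under eq_fun do rewrite big_ord0; exact: L2_cst.
by under eq_fun do rewrite big_ord_recr/=; exact: L2D.
Qed.

Lemma ae_bounded_cst c : ae_bounded (fun=> c).
Proof. by exists (abs2 c); apply: aeW. Qed.

Lemma ae_boundedD f g : ae_bounded f -> ae_bounded g ->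
  ae_bounded (fun z => f z + g z).
Proof.
move=> [A fA] [B gB]; exists (2 * A + 2 * B); apply: filterS2 fA gB => z fz gz.
by rewrite (le_trans (abs2D_le _ _))// lerD// ler_pM2l.
Qed.

Lemma ae_boundedM f g : ae_bounded f -> ae_bounded g ->
  ae_bounded (fun z => f z * g z).
Proof.
move=> [A fA] [B gB]; exists (A * B); apply: filterS2 fA gB => z fz gz.
by rewrite abs2M ler_pM ?abs2_ge0.
Qed.

Lemma ae_bounded_conj f : ae_bounded f -> ae_bounded (fun z => (f z)^*).
Proof. by move=> [A fA]; exists A; apply: filterS fA => z; rewrite abs2_conj. Qed.

Lemma ae_bounded_sum n (F : nat -> T -> C) : (forall i, ae_bounded (F i)) ->
  ae_bounded (fun z => \sum_(i < n) F i z).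
Proof.
move=> bF; elim: n => [|n IH].
  by under eq_fun do rewrite big_ord0; exact: ae_bounded_cst.
by under eq_fun do rewrite big_ord_recr/=; exact: ae_boundedD.
Qed.

Lemma eq_nsq f g : cmeasurable f -> cmeasurable g -> eq_ae f g -> nsq f = nsq g.
Proof.
move=> mf mg fg; congr fine; apply: ae_eq_integral => //;
  try by apply/measurable_EFinP; exact: measurable_abs2.
by apply: filterS fg => z -> _.
Qed.

Lemma nsqZ c f : L2 f -> nsq (fun z => c * f z) = abs2 c * nsq f.
Proof.
move=> Lf; rewrite /nsq -RintegralZl//; last exact: integrable_abs2.
by congr Rintegral; apply/funext => z; rewrite abs2M.
Qed.

Lemma nsqD_le f g : L2 f -> L2 g ->
  nsq (fun z => f z + g z) <= 2 * nsq f + 2 * nsq g.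
Proof.
move=> Lf Lg; have fi := integrable_abs2 Lf; have gi := integrable_abs2 Lg.
have i1 : m.-integrable setT (fun z => (2 * abs2 (f z))%:E).
  by under eq_fun do rewrite EFinM; exact: integrableZl.
have i2 : m.-integrable setT (fun z => (2 * abs2 (g z))%:E).
  by under eq_fun do rewrite EFinM; exact: integrableZl.
rewrite /nsq -RintegralZl// -(RintegralZl _ _ gi)// -(RintegralD _ i1 i2)//.
apply: le_Rintegral => //; first exact: integrable_abs2 (L2D Lf Lg).
  by under [X in _.-integrable _ X]eq_fun do rewrite EFinD; exact: integrableD.
by move=> z _; exact: abs2D_le.
Qed.

Lemma nsqN f : nsq (fun z => - f z) = nsq f.
Proof. by congr Rintegral; apply/funext => z; rewrite abs2N. Qed.

Lemma nsqBC f g : nsq (fun z => f z - g z) = nsq (fun z => g z - f z).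
Proof. by rewrite -nsqN; congr nsq; apply/funext => z; rewrite opprB. Qed.

Lemma nsq_eq0 f : L2 f -> nsq f = 0 -> eq_ae f (cst 0).
Proof.
move=> Lf /eqP; rewrite -eqe EFin_nsq// => /eqP f0.
have mf : measurable_fun setT (fun z => (abs2 (f z))%:E).
  by apply/measurable_EFinP/measurable_abs2/L2_cmeasurable.
have : (\int[m]_z `|(abs2 (f z))%:E| = 0)%E.
  by rewrite -[RHS]f0; apply: eq_integral => z _; rewrite gee0_abs ?lee_fin ?abs2_ge0.
move/(ae_eq_integral_abs m measurableT mf).
by apply: filterS => z /(_ I) [] /abs2_eq0.
Qed.

(** * The inner product of L^2 *)

Lemma cintegrable_inner f g : L2 f -> L2 g ->
  cintegrable m (fun z => f z * (g z)^*).
Proof.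
move=> /L2P[mf fi] /L2P[mg gi].
have [m1 m2] := cmeasurableM mf (cmeasurable_conj mg).
have fg : m.-integrable setT (fun z => (abs2 (f z) + abs2 (g z))%:E).
  by under eq_fun do rewrite EFinD; exact: integrableD.
split; apply: (@ae_le_integrable _ _ _ _ _ (fun z => abs2 (f z) + abs2 (g z))) => //;
  apply: aeW => z; rewrite ?cReM ?cImM cRe_conj cIm_conj /abs2 ler_norml.
- have := sqr_ge0 (complex.Re (f z) - complex.Re (g z)).
  have := sqr_ge0 (complex.Im (f z) - complex.Im (g z)).
  have := sqr_ge0 (complex.Re (f z) + complex.Re (g z)).
  have := sqr_ge0 (complex.Im (f z) + complex.Im (g z)).
  by move=> *; apply/andP; split; nra.
- have := sqr_ge0 (complex.Re (f z) - complex.Im (g z)).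
  have := sqr_ge0 (complex.Im (f z) - complex.Re (g z)).
  have := sqr_ge0 (complex.Re (f z) + complex.Im (g z)).
  have := sqr_ge0 (complex.Im (f z) + complex.Re (g z)).
  by move=> *; apply/andP; split; nra.
Qed.

Lemma innerDl f g h : L2 f -> L2 g -> L2 h ->
  inner (fun z => f z + g z) h = inner f h + inner g h.
Proof.
move=> Lf Lg Lh; rewrite /inner -!/(cint _ _) -cintD; try exact: cintegrable_inner.
by apply: eq_cint => z; rewrite mulrDl.
Qed.

Lemma innerZl c f h : L2 f -> L2 h ->
  inner (fun z => c * f z) h = c * inner f h.
Proof.
move=> Lf Lh; rewrite /inner -!/(cint _ _) -cintZ; last exact: cintegrable_inner.
by apply: eq_cint => z; rewrite mulrA.
Qed.

Lemma innerC f g : L2 f -> L2 g -> inner g f = (inner f g)^*.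
Proof.
move=> Lf Lg; rewrite /inner -!/(cint _ _) -cint_conj; last exact: cintegrable_inner.
by apply: eq_cint => z; rewrite rmorphM /= conjCK mulrC.
Qed.

Lemma innerNl f h : L2 f -> L2 h -> inner (fun z => - f z) h = - inner f h.
Proof.
move=> Lf Lh; have -> : (fun z => - f z) = fun z => -1 * f z.
  by apply/funext => z; rewrite mulN1r.
by rewrite (innerZl _ Lf Lh) mulN1r.
Qed.

Lemma innerBl f g h : L2 f -> L2 g -> L2 h ->
  inner (fun z => f z - g z) h = inner f h - inner g h.
Proof. by move=> Lf Lg Lh; rewrite innerDl// ?innerNl//; exact: L2N. Qed.

Lemma innerDr f g h : L2 f -> L2 g -> L2 h ->
  inner h (fun z => f z + g z) = inner h f + inner h g.
Proof.
move=> Lf Lg Lh; rewrite innerC//; last exact: L2D.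
by rewrite innerDl// rmorphD/= -(innerC Lf Lh) -(innerC Lg Lh).
Qed.

Lemma innerZr c f h : L2 f -> L2 h ->
  inner h (fun z => c * f z) = c^* * inner h f.
Proof.
by move=> Lf Lh; rewrite innerC ?innerZl ?rmorphM/= -?(innerC Lf Lh)//; exact: L2Z.
Qed.

Lemma innerNr f h : L2 f -> L2 h -> inner h (fun z => - f z) = - inner h f.
Proof. by move=> Lf Lh; rewrite innerC ?innerNl ?rmorphN/= -?(innerC Lf Lh)//; exact: L2N. Qed.

Lemma innerBr f g h : L2 f -> L2 g -> L2 h ->
  inner h (fun z => f z - g z) = inner h f - inner h g.
Proof. by move=> Lf Lg Lh; rewrite innerDr// ?innerNr//; exact: L2N. Qed.

Lemma inner0l h : inner (cst 0) h = 0.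
Proof.
by apply: complex_eqP; rewrite /= /Rintegral integral0_eq// => z _; rewrite mul0r.
Qed.

Lemma inner_suml n (F : nat -> T -> C) h : (forall i, L2 (F i)) -> L2 h ->
  inner (fun z => \sum_(i < n) F i z) h = \sum_(i < n) inner (F i) h.
Proof.
move=> LF Lh; elim: n => [|n IH].
  by under eq_fun do rewrite big_ord0; rewrite big_ord0 inner0l.
under eq_fun do rewrite big_ord_recr/=.
by rewrite innerDl// ?IH ?big_ord_recr//; exact: L2_sum.
Qed.

Lemma inner_mull u f g :
  inner (fun z => u z * f z) g = inner f (fun z => (u z)^* * g z).
Proof.
by apply: eq_cint => z; rewrite rmorphM/= conjCK mulrCA mulrA.
Qed.

Lemma inner_conj f g : L2 f -> L2 g ->
  inner (fun z => (f z)^*) (fun z => (g z)^*) = (inner f g)^*.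
Proof.
move=> Lf Lg; rewrite -innerC//; apply: eq_cint => z.
by rewrite conjCK mulrC.
Qed.

Lemma eq_innerl f g h : L2 f -> L2 g -> L2 h -> eq_ae f g ->
  inner f h = inner g h.
Proof.
move=> /L2_cmeasurable mf /L2_cmeasurable mg /L2_cmeasurable mh fg.
apply: ae_eq_cint; try by apply: cmeasurableM => //; exact: cmeasurable_conj.
by apply: filterS fg => z ->.
Qed.

Lemma eq_innerr f g h : L2 f -> L2 g -> L2 h -> eq_ae f g ->
  inner h f = inner h g.
Proof.
by move=> Lf Lg Lh fg; rewrite innerC// (eq_innerl Lf Lg Lh fg) -innerC.
Qed.

Lemma inner_nsq f : inner f f = (nsq f)%:C.
Proof.
apply: complex_eqP => /=.
  by congr Rintegral; apply/funext => z; rewrite -abs2E.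
by rewrite /Rintegral integral0_eq// => z _; rewrite -abs2E.
Qed.

Lemma nsqD f g : L2 f -> L2 g ->
  nsq (fun z => f z + g z) = nsq f + nsq g + 2 * complex.Re (inner f g).
Proof.
move=> Lf Lg; apply: (@complexI R); rewrite -inner_nsq.
have Lfg := L2D Lf Lg.
rewrite innerDl// !innerDr// (innerC Lf Lg) !inner_nsq.
by apply: complex_eqP; rewrite ?cReD ?cImD ?cRe_conj ?cIm_conj /=; ring.
Qed.

Lemma nsqD_orth f g : L2 f -> L2 g -> inner f g = 0 ->
  nsq (fun z => f z + g z) = nsq f + nsq g.
Proof. by move=> Lf Lg fg; rewrite nsqD// fg/= mulr0 addr0. Qed.

Lemma cauchy_schwarz f g : L2 f -> L2 g -> abs2 (inner f g) <= nsq f * nsq g.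
Proof.
move=> Lf Lg.
(* N f - c g is N times the component of f orthogonal to g *)
pose N := nsq g; pose c := inner f g.
have : 0 <= nsq (fun z => N%:C * f z + - c * g z) by exact: nsq_ge0.
have Lf' := L2Z N%:C Lf; have Lg' := L2Z (- c) Lg.
rewrite nsqD// !nsqZ// innerZl// innerZr// -/c abs2_real abs2N -/N.
have -> : complex.Re (N%:C * ((- c)^* * c)) = - N * abs2 c.
  have -> : (- c)^* * c = - (abs2 c)%:C by rewrite abs2E; ring.
  by rewrite -rmorphN -rmorphM /=; ring.
move=> H.
have [N0|N0] := eqVneq N 0.
  have g0 := nsq_eq0 Lg N0.
  rewrite N0 mulr0 -/c /c (@eq_innerr g (cst 0)) //; last exact: L2_cst.
  rewrite innerC//; last exact: L2_cst.
  by rewrite inner0l conjC0 abs20.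
have Np : 0 < N by rewrite lt_def N0 nsq_ge0.
rewrite -(ler_pM2l Np) -/N.
have e : N ^+ 2 * nsq f + abs2 c * N + 2 * (- N * abs2 c) = N * (nsq f * N) - N * abs2 c by ring.
by move: H; rewrite e subr_ge0.
Qed.

End L2_circle.

(** * Trigonometric system on the circle *)

Section circle_integration.
Variable R : realType.
Local Notation C := R[i].
Local Notation T := (circle R).
Local Notation m := (circle_measure R).
Local Notation leb := (@lebesgue_measure R).

(** The sigma-algebra of the circle is the image of the Borel sets of the
    line, so that measurability can be tested in the parameter. *)
Lemma measurable_circle d (Y : measurableType d) (f : T -> Y) :
  measurable_fun setT (f \o @circle_param R : measurableTypeR R -> Y) ->
  measurable_fun setT f.
Proof.
move=> mf _ B mB; rewrite setTI.
exact: (mf measurableT B mB).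
Qed.

Let measurable_param (f : T -> R) : measurable_fun setT f ->
  measurable_fun setT (f \o @circle_param R : measurableTypeR R -> R).
Proof. by move=> mf; exact: measurableT_comp. Qed.

Lemma ge0_integral_circle (g : T -> \bar R) :
  measurable_fun setT g -> (forall z, 0 <= g z)%E ->
  (\int[m]_z g z = \int[leb]_(t in `[0%R, 1%R]) g (circle_param t))%E.
Proof.
move=> mg g0; rewrite ge0_integral_distribution//.
rewrite integral_uniform//=.
- by rewrite subr0 invr1 mul1e.
- by apply: measurableT_comp => //.
Qed.

Lemma integrable_circle (f : T -> R) : m.-integrable setT (EFin \o f) ->
  leb.-integrable `[0, 1] (fun t => (f (circle_param t))%:E).
Proof.
move=> /integrableP[mf foo].
have mf' : measurable_fun setT f by exact/measurable_EFinP.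
apply/integrableP; split.
  by apply/measurable_EFinP; apply: measurable_funTS; exact: measurable_param.
by move: foo; rewrite ge0_integral_circle//; exact: measurableT_comp.
Qed.

Lemma Rintegral_circle (f : T -> R) : m.-integrable setT (EFin \o f) ->
  (\int[m]_z f z = \int[leb]_(t in `[0%R, 1%R]) f (circle_param t))%R.
Proof.
move=> /integrableP[mf foo]; congr fine.
rewrite integralE [RHS]integralE; congr (_ - _)%E.
  rewrite (ge0_integral_circle (measurable_funepos mf)) => [|z]; last exact: funepos_ge0.
  by apply: eq_integral => t _; rewrite !funeposE.
rewrite (ge0_integral_circle (measurable_funeneg mf)) => [|z]; last exact: funeneg_ge0.
  by apply: eq_integral => t _; rewrite !funenegE.
Qed.

(** The endpoints of the parameter interval form a null set, which leaves the
    open interval, where primitives can be differentiated. *)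
Lemma ae_circle (P : T -> Prop) : measurable [set z | P z] ->
  {ae leb, forall t, `]0, 1[%classic t -> P (circle_param t)} ->
  {ae m, forall z, P z}.
Proof.
move=> mP aeP.
have mN : measurable (~` [set z | P z]) by exact: measurableC.
exists (~` [set z | P z]); split=> //.
have -> : m (~` [set z | P z]) = (\int[m]_z (\1_(~` [set z | P z]) z)%:E)%E.
  by rewrite integral_indic// setIT.
rewrite ge0_integral_circle//; last first.
  by apply/measurable_EFinP; exact: measurable_indic.
have e : ae_eq leb `[0, 1]%classic (fun t => (\1_(~` [set z | P z]) (circle_param t))%:E)
    (cst 0%E : R -> \bar R).
  have n01 (a : R) : {ae leb, forall t, t <> a}.
    exists [set a]; split => //; first exact: lebesgue_measure_set1.
    by move=> t /= /contrapT.
  apply: (@filterS3 _ _ (ae_filter_ringOfSetsType leb)) aeP (n01 0) (n01 1) => t Pt t0 t1 /= t01.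
  rewrite indicE memNset//= => nP; apply: nP; apply: Pt.
  move: t01; rewrite /= !in_itv/= => /andP[a b].
  by rewrite !lt_neqAle a b !andbT eq_sym; apply/andP; split; exact/eqP.
rewrite (ae_eq_integral _ _ _ _ _ e)//; first by rewrite integral0.
apply/measurable_EFinP; apply: measurable_funTS.
by apply: measurable_param; exact: measurable_indic.
Qed.

Definition zeta : T -> C := fun z => val z.

Lemma zeta_param t :
  zeta (circle_param t) = (cos (2 * pi * t) +i* sin (2 * pi * t))%C.
Proof. by []. Qed.

Lemma continuous_lin (a : R) : continuous (fun t : R => a * t).
Proof. by move=> x; apply: cvgM; [exact: cvg_cst|exact: cvg_id]. Qed.

Lemma cmeasurable_zeta : cmeasurable zeta.
Proof.
split; apply: measurable_circle; apply: continuous_measurable_fun => x /=.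
  by apply: continuous_comp; [exact: continuous_lin|exact: continuous_cos].
by apply: continuous_comp; [exact: continuous_lin|exact: continuous_sin].
Qed.

Lemma zetaJ z : zeta z * (zeta z)^* = 1.
Proof.
by case: z => w w1; rewrite /zeta/= -normCK (eqP w1) expr1n.
Qed.

Lemma abs2_zeta z : abs2 (zeta z) = 1.
Proof. by apply: (@complexI R); rewrite abs2E zetaJ. Qed.

Lemma zetaX_param n t : zeta (circle_param t) ^+ n =
  (cos (2 * pi * n%:R * t) +i* sin (2 * pi * n%:R * t))%C.
Proof.
elim: n => [|n IH]; first by rewrite mulr0 mul0r cos0 sin0.
rewrite exprS IH zeta_param.
have -> : 2 * pi * n.+1%:R * t = 2 * pi * t + 2 * pi * n%:R * t :> R.
  by rewrite -natr1; ring.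
by rewrite cosD sinD; apply: complex_eqP; rewrite ?cReM ?cImM/=; ring.
Qed.

Lemma is_derive_lin (a x : R) : is_derive x 1 (fun t : R => a * t) a.
Proof.
have -> : (fun t : R => a * t) = a *: (id : R -> R) by [].
by apply: is_derive_eq; rewrite /GRing.scale/= mulr1.
Qed.

Lemma FTC_everywhere (F f : R -> R) :
  (forall x : R, is_derive x 1 F (f x)) -> continuous f ->
  (\int[leb]_(t in `[0%R, 1%R]) f t)%R = F 1 - F 0.
Proof.
move=> dF cf; have cF : continuous F.
  by move=> x; apply/differentiable_continuous/derivable1_diffP; case: (dF x).
rewrite /Rintegral (@continuous_FTC2 _ f F)//.
- exact: continuous_subspaceT.
- split; first by move=> x _; case: (dF x).
  + by apply: cvg_at_right_filter; exact: cF.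
  + by apply: cvg_at_left_filter; exact: cF.
- by move=> x _; rewrite derive1E; case: (dF x).
Qed.

Lemma L2_zetaX n : L2 (fun z => zeta z ^+ n).
Proof.
apply: L2_bounded; first exact: cmeasurableX cmeasurable_zeta.
by exists 1; apply: aeW => z; rewrite abs2X abs2_zeta expr1n.
Qed.

(** For n > 0 the real and imaginary parts of exp(2 i pi n t) have primitives
    that take the same value at 0 and 1. *)
Lemma cint_zetaX n : cint m (fun z => zeta z ^+ n) = (n == 0%N)%:R.
Proof.
have [->|n0] := eqVneq n 0%N.
  apply: complex_eqP => /=; rewrite Rintegral_cst//= ?mul0r//.
  by rewrite probability_setT mulr1.
have a0 : 2 * pi * n%:R != 0 :> R.
  by rewrite !mulf_neq0 ?pnatr_eq0// gt_eqF// pi_gt0.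
have e : (fun z : T => zeta z ^+ n * 1^*) = (fun z => zeta z ^+ n).
  by apply/funext => z; rewrite rmorph1 mulr1.
have [i1 i2] : cintegrable m (fun z => zeta z ^+ n).
  by rewrite -e; exact: cintegrable_inner (L2_zetaX n) (L2_cst 1).
have cn (x : R) : 2 * pi * n%:R = x -> cos x = 1 /\ sin x = 0.
  move=> <-; elim: (n) => [|k [IHc IHs]]; first by rewrite mulr0 cos0 sin0.
  have -> : 2 * pi * k.+1%:R = 2 * pi * k%:R + pi *+ 2 :> R.
    by rewrite -addn1 natrD -mulr_natl; ring.
  split; first by rewrite cosD IHc IHs cos2pi mul1r mul0r subr0.
  by rewrite sinD IHc IHs sin2pi mulr0 mul0r addr0.
have {cn}[cn sn] := cn _ erefl.
have dsin (x : R) : is_derive x 1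
    (fun t => (2 * pi * n%:R)^-1 * sin (2 * pi * n%:R * t))
    (cos (2 * pi * n%:R * x)).
  have d1 := is_derive_lin (2 * pi * n%:R) x.
  have d2 := @is_derive1_comp _ (@sin R) _ x _ _ (is_derive_sin _) d1.
  have d3 := @is_deriveZ _ _ _ _ (2 * pi * n%:R)^-1 _ _ _ d2.
  apply: is_derive_eq d3 _.
  by rewrite /GRing.scale/= mulrCA mulVf// mulr1.
have dcos (x : R) : is_derive x 1
    (fun t => - (2 * pi * n%:R)^-1 * cos (2 * pi * n%:R * t))
    (sin (2 * pi * n%:R * x)).
  have d1 := is_derive_lin (2 * pi * n%:R) x.
  have d2 := @is_derive1_comp _ (@cos R) _ x _ _ (is_derive_cos _) d1.
  have d3 := @is_deriveZ _ _ _ _ (- (2 * pi * n%:R)^-1) _ _ _ d2.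
  apply: is_derive_eq d3 _.
  by rewrite scaleNr mulNr scalerN opprK /GRing.scale/= mulrCA mulVf// mulr1.
apply: complex_eqP => /=.
  rewrite Rintegral_circle; last exact: i1.
  under eq_Rintegral do rewrite zetaX_param/=.
  rewrite (FTC_everywhere dsin); last first.
    by move=> x; apply: continuous_comp; [exact: continuous_lin|exact: continuous_cos].
  by rewrite mulr1 !mulr0 sn sin0 mulr0 subrr.
rewrite Rintegral_circle; last exact: i2.
under eq_Rintegral do rewrite zetaX_param/=.
rewrite (FTC_everywhere dcos); last first.
  by move=> x; apply: continuous_comp; [exact: continuous_lin|exact: continuous_sin].
by rewrite mulr1 !mulr0 cn cos0 mulr1 subrr.
Qed.

End circle_integration.

(** * Polynomial approximation of a threshold *)

Section threshold.
Variable R : realType.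

Lemma bernoulli_ineq (x : R) n : 0 <= x -> 1 + n%:R * x <= (1 + x) ^+ n.
Proof.
move=> x0; elim: n => [|n IH]; first by rewrite mul0r addr0 expr0.
rewrite exprS; apply: le_trans (ler_wpM2l _ IH); last by rewrite addr_ge0.
have : 0 <= n%:R * x ^+ 2 by rewrite mulr_ge0// sqr_ge0.
by rewrite -natr1; nra.
Qed.

Lemma cvg_natM_expr (r : R) : 0 <= r < 1 -> n%:R * r ^+ n @[n --> \oo] --> 0.
Proof.
move=> /andP[r0 r1].
(* n r^n = (n s^n) s^n with s the square root of r, and n s^n is bounded *)
have [->|rn0] := eqVneq r 0.
  apply: cvg_near_cst; near=> n.
  by rewrite expr0n gtn_eqF ?mulr0//; near: n; exists 1%N.
have rp : 0 < r by rewrite lt_def rn0.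
pose s := Num.sqrt r.
have s0 : 0 < s by rewrite sqrtr_gt0.
have s1 : s < 1 by rewrite -sqrtr1 ltr_sqrt.
pose h := s^-1 - 1.
have h0 : 0 < h by rewrite subr_gt0 invf_gt1.
have hs : s^-1 = 1 + h by rewrite /h; ring.
apply: (@squeeze_cvgr _ _ _ _ (fun=> 0) (fun n => h^-1 * s ^+ n)).
- apply: nearW => n; rewrite mulr_ge0 ?exprn_ge0//=.
  have -> : r ^+ n = s ^+ n * s ^+ n by rewrite -exprMn -expr2 sqr_sqrtr.
  rewrite mulrA ler_pM2r ?exprn_gt0// -ler_pdivlMr ?exprn_gt0//.
  rewrite -exprVn hs -ler_pdivrMl ?invr_gt0// invrK mulrC.
  by apply: le_trans (bernoulli_ineq n (ltW h0)); rewrite lerDr.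
- exact: cvg_cst.
- have := @cvg_geometric R h^-1 s; rewrite ger0_norm ?(ltW s0)// => /(_ s1).
  exact.
Unshelve. all: by end_near. Qed.

(** For y < 1/2, Bernoulli bounds the term below by 1 - n (2 y)^n. For y >=
    1/2, put u = y^n and k = n 2^n: since (1 - u)^k (1 + u)^k <= 1 and (1 +
    u)^k >= 1 + k u >= 1 + n, the term is at most 1 / (1 + n). The factor n in
    the exponent is what settles the case y = 1/2, where (1 - y^n)^(2^n) would
    tend to 1/e. *)
Lemma cvg_threshold (y : R) : 0 <= y <= 1 ->
  (1 - y ^+ n) ^+ (n * 2 ^ n) @[n --> \oo] --> ((y < 2^-1)%R%:R : R).
Proof.
move=> /andP[y0 y1].
have yn n : 0 <= 1 - y ^+ n <= 1.
  by rewrite subr_ge0 exprn_ile1//= lerBlDr lerDl exprn_ge0.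
have mE n : (n * 2 ^ n)%:R * y ^+ n = n%:R * (2 * y) ^+ n :> R.
  by rewrite natrM natrX exprMn mulrA.
have [y2|y2] := ltP y 2^-1.
  apply: (@squeeze_cvgr _ _ _ _ (fun n => 1 - n%:R * (2 * y) ^+ n) (fun=> 1)).
  - apply: nearW => n; have /andP[a b] := yn n.
    rewrite exprn_ile1// andbT -mE.
    elim: (n * 2 ^ n)%N => [|k IH]; first by rewrite mul0r subr0 expr0.
    rewrite exprS; have [k0|k0] := leP 0 (1 - k%:R * y ^+ n).
      apply: le_trans (ler_wpM2l a IH).
      have := exprn_ge0 n y0; have : 0 <= k%:R :> R by [].
      by rewrite -natr1; nra.
    apply: (@le_trans _ _ 0); last by rewrite mulr_ge0 ?exprn_ge0.
    apply: le_trans (ltW k0).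
    by rewrite lerD2l lerN2 ler_wpM2r ?exprn_ge0// ler_nat.
  - rewrite -[X in _ --> X](subr0 1); apply: cvgB; first exact: cvg_cst.
    apply: cvg_natM_expr; rewrite mulr_ge0//=.
    by rewrite -ltr_pdivlMl// mulr1.
  - exact: cvg_cst.
apply: (@squeeze_cvgr _ _ _ _ (fun=> 0) (@harmonic R)).
- apply: nearW => n; have /andP[a b] := yn n; rewrite exprn_ge0//=.
  set k := (n * 2 ^ n)%N; set u := y ^+ n.
  have u0 : 0 <= u by exact: exprn_ge0.
  have B := bernoulli_ineq k u0.
  have P : (1 - u) ^+ k * (1 + u) ^+ k <= 1.
    rewrite -exprMn exprn_ile1//; first by rewrite mulr_ge0// addr_ge0.
    by nra.
  have nk : n.+1%:R <= 1 + k%:R * u.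
    rewrite mE -natr1 addrC lerD2l ler_peMr// exprn_ege1//.
    by rewrite -ler_pdivrMl// mulr1.
  rewrite /harmonic -[leRHS]mul1r ler_pdivlMr//.
  apply: le_trans P; apply: ler_wpM2l; first exact: exprn_ge0.
  exact: le_trans nk B.
- exact: cvg_cst.
- exact: cvg_harmonic.
Qed.

End threshold.

(** * Fourier coefficients *)

Section fourier_coefficients.
Variable R : realType.
Local Notation C := R[i].
Local Notation T := (circle R).
Implicit Types (f g : T -> C) (j k l : int).

Definition ez k : T -> C := fun z => zeta z ^ k.

Lemma zeta_neq0 (z : T) : zeta z != 0.
Proof.
by apply/negP => /eqP z0; have := abs2_zeta z; rewrite z0 abs20 => /esym/eqP; rewrite oner_eq0.
Qed.

Lemma ez0 z : ez 0 z = 1. Proof. exact: expr0z. Qed.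

Lemma ezD k l z : ez (k + l) z = ez k z * ez l z.
Proof. by rewrite /ez expfzDr// zeta_neq0. Qed.

Lemma ezJ k z : (ez k z)^* = ez (- k) z.
Proof.
have zV : (zeta z)^* = (zeta z)^-1.
  by apply: (mulfI (zeta_neq0 z)); rewrite zetaJ mulfV// zeta_neq0.
by rewrite /ez fmorphXz/= zV exprz_inv.
Qed.

Lemma abs2_ez k z : abs2 (ez k z) = 1.
Proof.
apply: (@complexI R); rewrite abs2E ezJ -ezD subrr ez0//.
Qed.

Lemma cmeasurable_ez k : cmeasurable (ez k).
Proof.
case: k => n; first exact: (cmeasurableX n (@cmeasurable_zeta R)).
have -> : ez (Negz n) = fun z => (zeta z ^+ n.+1)^*.
  by apply/funext => z; rewrite NegzE -ezJ.
exact: cmeasurable_conj (cmeasurableX n.+1 (@cmeasurable_zeta R)).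
Qed.

Lemma ae_bounded_ez k : ae_bounded (ez k).
Proof. by exists 1; apply: aeW => z; rewrite abs2_ez. Qed.

Lemma L2_ez k : L2 (ez k).
Proof. exact: L2_bounded (cmeasurable_ez k) (ae_bounded_ez k). Qed.

Lemma L2_ezM k f : L2 f -> L2 (fun z => ez k z * f z).
Proof. exact: L2M (cmeasurable_ez k) (ae_bounded_ez k). Qed.

Lemma inner_ezM j f k :
  inner (fun z => ez j z * f z) (ez k) = inner f (ez (k - j)).
Proof.
rewrite inner_mull; congr inner; apply/funext => z.
by rewrite ezJ -ezD addrC.
Qed.

Lemma inner_conj_ez f k : L2 f ->
  inner (fun z => (f z)^*) (ez k) = (inner f (ez (- k)))^*.
Proof.
move=> Lf; rewrite -inner_conj//; last exact: L2_ez.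
by congr inner; apply/funext => z; rewrite ezJ opprK.
Qed.

Lemma inner_ez k l : inner (ez k) (ez l) = (k == l)%:R.
Proof.
have e1 n : inner (ez (Posz n)) (ez 0) = (n == 0%N)%:R.
  rewrite -cint_zetaX; apply: eq_cint => z.
  by rewrite ez0 rmorph1 mulr1.
have -> : ez k = fun z => ez l z * ez (k - l) z.
  by apply/funext => z; rewrite -ezD addrC subrK.
rewrite inner_ezM subrr -subr_eq0; case: (k - l) => n; first exact: e1.
have -> : ez (Negz n) = fun z => (ez (Posz n.+1) z)^*.
  by apply/funext => z; rewrite ezJ NegzE.
by rewrite inner_conj_ez ?oppr0 ?e1 ?conjC0//; exact: L2_ez.
Qed.

Lemma nsq_ez k : nsq (ez k) = 1.
Proof. by apply: (@complexI R); rewrite -inner_nsq inner_ez eqxx. Qed.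

End fourier_coefficients.

(** * Uniqueness of Fourier coefficients *)

Section fourier_uniqueness.
Variable R : realType.
Local Notation C := R[i].
Local Notation T := (circle R).
Local Notation m := (circle_measure R).
Local Notation leb := (@lebesgue_measure R).
Implicit Types (f g : T -> C).

Definition fourier_null f := L2 f /\ forall k, inner f (@ez R k) = 0.

Lemma fourier_null_ezM j f :
  fourier_null f -> fourier_null (fun z => ez j z * f z).
Proof.
by move=> [Lf f0]; split=> [|k]; [exact: L2_ezM|rewrite inner_ezM f0].
Qed.

Lemma fourier_nullD f g : fourier_null f -> fourier_null g ->
  fourier_null (fun z => f z + g z).
Proof.
move=> [Lf f0] [Lg g0]; split=> [|k]; first exact: L2D.
by rewrite innerDl ?f0 ?g0 ?addr0//; exact: L2_ez.
Qed.

Lemma fourier_nullZ c f : fourier_null f -> fourier_null (fun z => c * f z).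
Proof.
move=> [Lf f0]; split=> [|k]; first exact: L2Z.
by rewrite innerZl ?f0 ?mulr0//; exact: L2_ez.
Qed.

(** At exp(2 i pi t) this is 1/2 - sin(pi t) sin(pi (b - t)) / 2, so that for
    t in [0, 1] it is less than 1/2 exactly when 0 < t < b. *)
Definition arc (b : R) (z : T) : R :=
  2^-1 - (complex.Re (zeta z) * cos (pi * b) +
          complex.Im (zeta z) * sin (pi * b) - cos (pi * b)) / 4.

Lemma arc_itv b z : 0 <= arc b z <= 1.
Proof.
have := abs2_zeta z; rewrite /abs2 /arc.
have := cos2Dsin2 (pi * b).
move: (complex.Re _) (complex.Im _) (cos _) (sin _) => x y c s cs xy.
have h1 : x * c + y * s <= 1.
  by have := sqr_ge0 (x - c); have := sqr_ge0 (y - s); nra.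
have h2 : - 1 <= x * c + y * s.
  by have := sqr_ge0 (x + c); have := sqr_ge0 (y + s); nra.
have c1 : c <= 1 by have := sqr_ge0 s; nra.
have c2 : -1 <= c by have := sqr_ge0 s; nra.
by apply/andP; split; lra.
Qed.

Lemma measurable_arc b : measurable_fun setT (arc b).
Proof.
have [m1 m2] := @cmeasurable_zeta R.
apply: measurable_funB; first exact: measurable_cst.
apply: measurable_funM; last exact: measurable_cst.
apply: measurable_funB; last exact: measurable_cst.
by apply: measurable_funD; apply: measurable_funM.
Qed.

Lemma arc_lt_half b t : 0 < b < 1 -> 0 <= t <= 1 ->
  (arc b (circle_param t) < 2^-1) = (0 < t < b).
Proof.
move=> /andP[b0 b1] /andP[t0 t1].
have pi0 := pi_gt0 R.
have -> : arc b (circle_param t) =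
    2^-1 - sin (pi * t) * sin (pi * (b - t)) / 2.
  rewrite /arc zeta_param/=.
  have -> : 2 * pi * t = pi * t + pi * t by ring.
  have -> : pi * (b - t) = pi * b - pi * t by ring.
  rewrite cosD sinD sinB.
  have := cos2Dsin2 (pi * t).
  move: (cos (pi * t)) (sin (pi * t)) (cos (pi * b)) (sin (pi * b)).
  move=> c s cb sb cs.
  have -> : c * c = 1 - s * s by rewrite -!expr2 -cs; ring.
  by field.
rewrite ltrBlDr ltrDl pmulr_lgt0 ?invr_gt0//.
have [->|tn0] := eqVneq t 0; first by rewrite mulr0 sin0 mul0r ltxx.
have tp : 0 < t by rewrite lt_def tn0.
rewrite tp/=.
have [t1'|tn1] := eqVneq t 1.
  by rewrite t1' mulr1 sinpi mul0r ltxx; apply/esym/negbTE; rewrite -leNgt ltW.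
have tl1 : t < 1 by rewrite lt_def eq_sym tn1.
rewrite pmulr_rgt0; last first.
  by rewrite sin_gt0_pi// mulr_gt0//= -[ltRHS]mulr1 ltr_pM2l.
have [tb|bt] := ltP t b.
  rewrite sin_gt0_pi// mulr_gt0 ?subr_gt0//= -[ltRHS]mulr1 ltr_pM2l//.
  by rewrite ltrBlDr (lt_le_trans b1)// lerDl.
apply/negbTE; rewrite -leNgt -oppr_ge0 -sinN -mulrN opprB.
rewrite sin_ge0_pi// mulr_ge0 ?subr_ge0 ?(ltW pi0)//=.
by rewrite -[leRHS]mulr1 ler_pM2l// lerBlDr (le_trans t1)// lerDl ltW.
Qed.

(** The function arc b is a trigonometric polynomial of degree one. *)
Lemma fourier_null_arcM b f :
  fourier_null f -> fourier_null (fun z => (arc b z)%:C * f z).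
Proof.
move=> nf.
pose c1 : C := (- cos (pi * b) / 8 +i* (sin (pi * b) / 8))%C.
have -> : (fun z => (arc b z)%:C * f z) =
    fun z => (2^-1 + cos (pi * b) / 4)%:C * f z +
      (c1 * (ez 1 z * f z) + c1^* * (ez (-1) z * f z)).
  apply/funext => z; rewrite !mulrA -!mulrDl; congr (_ * _).
  rewrite -ezJ /ez expr1z; apply: complex_eqP;
    rewrite !(cReD, cImD) !(cReM, cImM) !(cRe_conj, cIm_conj) /c1/= /arc; by field.
exact: (fourier_nullD (fourier_nullZ _ nf)
  (fourier_nullD (fourier_nullZ _ (fourier_null_ezM 1 nf))
                 (fourier_nullZ _ (fourier_null_ezM (-1) nf)))).
Qed.

Lemma fourier_null_thresholdM b f n k : fourier_null f ->
  fourier_null (fun z => ((1 - arc b z ^+ n) ^+ k)%:C * f z).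
Proof.
have powM j g : fourier_null g -> fourier_null (fun z => (arc b z ^+ j)%:C * g z).
  elim: j g => [|j IH] g ng; first by under eq_fun do rewrite expr0 mul1r.
  have -> : (fun z => (arc b z ^+ j.+1)%:C * g z) =
      fun z => (arc b z)%:C * ((arc b z ^+ j)%:C * g z).
    by apply/funext => z; rewrite exprS rmorphM/= mulrA.
  by apply: fourier_null_arcM; exact: IH.
elim: k f => [|k IH] f nf; first by under eq_fun do rewrite expr0 mul1r.
have -> : (fun z => ((1 - arc b z ^+ n) ^+ k.+1)%:C * f z) =
    fun z => ((1 - arc b z ^+ n) ^+ k)%:C *
      (f z + -1 * ((arc b z ^+ n)%:C * f z)).
  by apply/funext => z; rewrite exprS rmorphM/= rmorphB rmorph1/=; ring.
exact: IH _ (fourier_nullD nf (fourier_nullZ _ (powM n f nf))).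
Qed.

(** Dominated convergence: arc b takes its values in [0, 1], so the
    approximations of the threshold are bounded by 1. *)
Lemma Rintegral_threshold (h : T -> R) b : m.-integrable setT (EFin \o h) ->
  (forall n, (\int[m]_z ((1 - arc b z ^+ n) ^+ (n * 2 ^ n) * h z))%R = 0) ->
  (\int[m]_z ((arc b z < 2^-1)%R%:R * h z))%R = 0.
Proof.
move=> hi h0.
have mh : measurable_fun setT h by apply/measurable_EFinP; case/integrableP: hi.
pose F n z := ((1 - arc b z ^+ n) ^+ (n * 2 ^ n) * h z)%:E.
have mF n : measurable_fun setT (F n).
  apply/measurable_EFinP; apply: measurable_funM => //; apply: measurable_funX.
  apply: measurable_funB; first exact: measurable_cst.
  by apply: measurable_funX; exact: measurable_arc.
have Fcvg z : F n z @[n --> \oo] --> ((arc b z < 2^-1)%R%:R * h z)%:E.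
  apply: cvg_EFin; first exact: nearW.
  by apply: cvgM; [exact: cvg_threshold (arc_itv b z)|exact: cvg_cst].
have mF' : measurable_fun setT (fun z => ((arc b z < 2^-1)%R%:R * h z)%:E).
  exact: (emeasurable_fun_cvg _ _ mF).
have Fh n z : `|(1 - arc b z ^+ n) ^+ (n * 2 ^ n) * h z| <= `|h z|.
  have /andP[a0 a1] := arc_itv b z.
  rewrite normrM ler_piMl// normrX exprn_ile1// ler_norml.
  have := exprn_ge0 n a0; have := exprn_ile1 n a0 a1.
  by move=> *; apply/andP; split; lra.
have Fi n : m.-integrable setT (F n).
  apply: le_integrable hi => // z _ /=.
  by rewrite lee_fin.
have [_ _ dc] := dominated_convergence (mu := m) measurableT mF mF'
  (aeW _ (fun z _ => Fcvg z)) (integrable_norm hi)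
  (aeW _ (fun z n _ => Fh n z)).
rewrite /Rintegral -(cvg_lim _ dc)//.
rewrite (_ : [sequence _]_n = cst 0%E); first by rewrite lim_cst.
apply/funext => n /=; have := h0 n; rewrite /Rintegral.
move=> e; rewrite -[LHS]fineK; first by rewrite /F e.
exact: integrable_fin_num (Fi n).
Qed.

(** The primitive of h vanishing at 0 is zero on the parameter interval, and
    it has derivative h almost everywhere by the Lebesgue differentiation
    theorem. *)
Lemma ae_eq0_of_arcs (h : T -> R) : m.-integrable setT (EFin \o h) ->
  (forall b, 0 < b < 1 ->
    (\int[m]_z ((arc b z < 2^-1)%R%:R * h z))%R = 0) ->
  {ae m, forall z, h z = 0}.
Proof.
move=> hi h0.
have mh : measurable_fun setT h by apply/measurable_EFinP; case/integrableP: hi.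
pose H := fun t => h (circle_param t).
have Hi : leb.-integrable `[0, 1] (EFin \o H) by exact: integrable_circle.
pose u := H \_ `[0, 1].
have ui : leb.-integrable setT (EFin \o u).
  by rewrite /u -restrict_EFin; exact/(integrable_mkcond _ _).1.
have uS (D : set R) : measurable D -> leb.-integrable D (EFin \o u).
  by move=> mD; exact: integrableS ui.
have F0 (b : R) : 0 < b < 1 -> (\int[leb]_(t in `[0%R, b]) u t)%R = 0.
  move=> b01; rewrite -Rintegral_itv_obnd_cbnd; last first.
    exact: uS.
  rewrite -Rintegral_itv_bndo_bndc; last first.
    exact: uS.
  rewrite -[RHS](h0 b b01) Rintegral_circle; last first.
    apply: le_integrable hi => //.
      apply/measurable_EFinP/measurable_funM => //.
      by apply: measurableT_comp => //; apply: measurable_fun_ltr => //; exact: measurable_arc.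
    move=> z _ /=; rewrite lee_fin normrM ler_piMl//.
    by case: (arc b z < 2^-1)%R; rewrite ?normr1 ?normr0.
  rewrite Rintegral_mkcond [RHS]Rintegral_mkcond; congr Rintegral.
  apply/funext => t; rewrite /u !patchE.
  have /andP[b0 b1] := b01.
  case: ifPn => [/set_mem /=|]; rewrite ?in_itv/=.
    move=> /andP[t0 tb]; rewrite mem_set/= ?in_itv/= ?(ltW t0) ?(ltW (lt_trans tb b1))//.
    by rewrite arc_lt_half ?b01 ?t0 ?tb ?mul1r// (ltW t0) (ltW (lt_trans tb b1)).
  rewrite notin_setE/= in_itv/= => tn.
  case: ifPn => [/set_mem /=|//]; rewrite in_itv/= => t01.
  by rewrite arc_lt_half//; move/negP/negbTE: tn => ->; rewrite mul0r.
have := @FTC1 R u (BLeft 0) (fun y => uS _ (measurable_itv _))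
  (integrable_locally_restrict (measurable_itv _) Hi).
move=> ftc; apply: ae_circle.
  by have := mh measurableT [set 0] (measurable_set1 _); rewrite setTI.
apply: (@filterS _ _ (ae_filter_ringOfSetsType leb)) ftc => x /= ftc.
rewrite in_itv/= => /andP[x0 x1].
have [|_] := ftc; first by rewrite lte_fin.
rewrite /u patchE mem_set/= ?in_itv/= ?(ltW x0) ?(ltW x1)// => e.
rewrite -[LHS]/(H x) -e.
rewrite derive1E (@near_eq_derive _ _ _ _ (cst 0))//.
  by rewrite derive_cst.
near=> y; rewrite F0//; apply/andP; split; near: y.
- exact: lt_nbhsr.
- exact: lt_nbhsl.
Unshelve. all: by end_near. Qed.

(** Multiplication by exp(2 i pi k t) permutes the Fourier coefficients, so
    that a function with no Fourier coefficient is orthogonal to the algebra of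
    trigonometric polynomials, which contains bounded approximations of the
    indicator functions of arcs. *)
Lemma fourier_unique f : fourier_null f -> eq_ae f (cst 0).
Proof.
move=> nf; have [Lf _] := nf.
have [i1 i2] : cintegrable m f.
  have := cintegrable_inner Lf (L2_cst 1).
  by under eq_fun do rewrite rmorph1 mulr1.
have th b n : cint m (fun z => ((1 - arc b z ^+ n) ^+ (n * 2 ^ n))%:C * f z) = 0.
  have [_ /(_ 0) <-] := fourier_null_thresholdM b n (n * 2 ^ n) nf.
  by apply: eq_cint => z; rewrite ez0 rmorph1 mulr1.
have re0 : {ae m, forall z, complex.Re (f z) = 0}.
  apply: ae_eq0_of_arcs => // b b01; apply: Rintegral_threshold => // n.
  rewrite -[RHS]/(complex.Re (0 : C)) -(th b n) /=.
  by congr Rintegral; apply/funext => z; rewrite cReM/= mul0r subr0.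
have im0 : {ae m, forall z, complex.Im (f z) = 0}.
  apply: ae_eq0_of_arcs => // b b01; apply: Rintegral_threshold => // n.
  rewrite -[RHS]/(complex.Im (0 : C)) -(th b n) /=.
  by congr Rintegral; apply/funext => z; rewrite cImM/= mul0r addr0.
by apply: filterS2 re0 im0 => z a b; exact: complex_eqP.
Qed.

End fourier_uniqueness.

(** * Completeness of L^2 and the Riesz projection *)

Section L2_completeness.
Variable R : realType.
Local Notation C := R[i].
Local Notation T := (circle R).
Local Notation m := (circle_measure R).

(** With d_k the increments of G, the sum of 2^k |d_k|^2 has a finite
    integral, hence is finite almost everywhere; chi is the indicator function
    of the set where it is finite. There the real and imaginary parts of G k
    converge absolutely, because |x| <= 2^k x^2 + 2^(-k). *)
Lemma L2_fast_cauchy_ae_cvg (G : nat -> T -> C) : (forall k, L2 (G k)) ->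
  (forall k, nsq (fun z => G k.+1 z - G k z) <= (4^-1) ^+ k) ->
  exists (chi : T -> bool) (g : T -> C), [/\ measurable_fun setT chi,
    {ae m, forall z, chi z}, cmeasurable g &
    forall z, chi z ->
      (complex.Re (G k z) @[k --> \oo] --> complex.Re (g z)) /\
      (complex.Im (G k z) @[k --> \oo] --> complex.Im (g z))].
Proof.
move=> LG dG.
pose d k z := G k.+1 z - G k z.
have Ld k : L2 (d k) by exact: L2B.
pose B k z : \bar R := (2 ^+ k * abs2 (d k z))%:E.
have B0 k z : (0 <= B k z)%E by rewrite lee_fin mulr_ge0 ?exprn_ge0 ?abs2_ge0.
have mB k : measurable_fun setT (B k).
  by apply/measurable_EFinP/measurable_funM => //; exact/measurable_abs2/L2_cmeasurable.
pose S z : \bar R := (\sum_(k <oo) B k z)%E.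
have mS : measurable_fun setT S by apply: ge0_emeasurable_sum => //.
have S0 z : (0 <= S z)%E by exact: nneseries_ge0.
pose chi z := (S z < +oo)%E.
have mchi : measurable_fun setT chi.
  apply: (measurable_fun_bool true); rewrite setTI.
  have := measurable_lte measurableT mS (measurable_cst +oo%E).
  by rewrite setTI.
have intB k : (\int[m]_z B k z <= ((2^-1) ^+ k)%:E)%E.
  rewrite /B; under eq_integral do rewrite EFinM.
  rewrite ge0_integralZl//; last 2 first.
  - by apply/measurable_EFinP/measurable_abs2/L2_cmeasurable.
  - by move=> z _; rewrite lee_fin abs2_ge0.
  rewrite -EFin_nsq// -EFinM lee_fin; apply: le_trans (ler_wpM2l _ (dG k)) _.
    by rewrite exprn_ge0.
  by rewrite -exprMn (_ : 2 * 4^-1 = 2^-1)//; field.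
have aechi : {ae m, forall z, chi z}.
  have Si : m.-integrable setT S.
    apply/integrableP; split=> //; under eq_integral do rewrite gee0_abs//.
    rewrite /S integral_nneseries//; apply: (@le_lt_trans _ _ 2%:E); last exact: ltry.
    apply: lime_le.
      by apply: is_cvg_nneseries => k _ _; exact: integral_ge0.
    apply: nearW => n.
    apply: (@le_trans _ _ (2 - 2 * (2^-1) ^+ n)%:E); last first.
      by rewrite lee_fin lerBlDr lerDl mulr_ge0// exprn_ge0.
    elim: n => [|n IH]; first by rewrite big_geq// expr0 mulr1 subrr.
    rewrite big_nat_recr//=; apply: le_trans (leeD IH (intB n)) _.
    rewrite -EFinD lee_fin exprS.
    by have := exprn_ge0 n (_ : 0 <= 2^-1 :> R); lra.
  apply: filterS (integrable_ae measurableT Si) => z /(_ I).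
  by rewrite fin_num_abs gee0_abs.
have conv (p : C -> R) : (forall a b, p (a - b) = p a - p b) ->
    (forall a, p a ^+ 2 <= abs2 a) ->
    forall z, chi z -> cvgn (fun k => p (G k z)).
  move=> pB pa z Sz.
  have -> : (fun k => p (G k z)) =
      (fun k => p (G 0%N z) + series (fun j => p (d j z)) k).
    apply/funext; elim=> [|k IH]; first by rewrite /series/= big_geq// addr0.
    rewrite /series/= big_nat_recr//= addrA.
    by move: IH; rewrite /series/= => <-; rewrite pB addrC subrK.
  apply: is_cvgD; first exact: is_cvg_cst.
  apply: normed_cvg; apply: (@nondecreasing_is_cvgn _ _).
    by apply: nondecreasing_series => k _ _; exact: normr_ge0.
  exists (fine (S z) + 2) => _ [n _ <-].
  have Sfin : (fine (S z))%:E = S z by rewrite fineK// fin_num_abs gee0_abs.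
  apply: (@le_trans _ _ (\sum_(0 <= k < n) (2 ^+ k * abs2 (d k z) + (2^-1) ^+ k))).
    rewrite /series/=; apply: ler_sum => k _.
    (* arithmetic-geometric inequality with weights 2^k and 2^-k *)
    have := pa (d k z); set x := p (d k z); set a := abs2 _ => xa.
    have K0 : 0 < (2 : R) ^+ k by exact: exprn_gt0.
    rewrite exprVn; set K := 2 ^+ k in K0 *.
    apply: (@le_trans _ _ (K * x ^+ 2 + K^-1)); last by rewrite lerD2r ler_pM2l.
    rewrite -(ler_pM2l K0) mulrDr mulfV ?gt_eqF//.
    rewrite mulrA -expr2 -(real_normK (num_real x)) -exprMn.
    by have := sqr_ge0 (K * `|x| - 1); have := sqr_ge0 (K * `|x|); nra.
  rewrite big_split/= lerD//.
    rewrite -lee_fin Sfin -sumEFin.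
    by apply: nneseries_lim_ge => k _ _; exact: B0.
  apply: (@le_trans _ _ (2 - 2 * (2^-1) ^+ n)); last first.
    by rewrite lerBlDr lerDl mulr_ge0// exprn_ge0.
  elim: n => [|n IH]; first by rewrite big_geq// expr0 mulr1 subrr.
  rewrite big_nat_recr//= exprS.
  by have := exprn_ge0 n (_ : 0 <= 2^-1 :> R); lra.
have cRe z : chi z -> cvgn (fun k => complex.Re (G k z)).
  apply: conv => [a b|a]; first by rewrite cReD cReN.
  by rewrite lerDl sqr_ge0.
have cIm z : chi z -> cvgn (fun k => complex.Im (G k z)).
  apply: conv => [a b|a]; first by rewrite cImD cImN.
  by rewrite lerDr sqr_ge0.
pose g z : C := if chi z then (limn (fun k => complex.Re (G k z)) +i*
  limn (fun k => complex.Im (G k z)))%C else 0.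
exists chi, g; split=> //; last first.
  by move=> z cz; rewrite /g cz; split; [exact: cRe|exact: cIm].
split.
  apply: (@measurable_fun_cvg _ _ _ _
      (fun k z => if chi z then complex.Re (G k z) else 0)).
    by move=> k; apply: measurable_fun_ifT => //; case: (L2_cmeasurable (LG k)).
  move=> z _; rewrite /g; case: ifP => cz /=; first exact: cRe.
  exact: cvg_cst.
apply: (@measurable_fun_cvg _ _ _ _
    (fun k z => if chi z then complex.Im (G k z) else 0)).
  by move=> k; apply: measurable_fun_ifT => //; case: (L2_cmeasurable (LG k)).
move=> z _; rewrite /g; case: ifP => cz /=; first exact: cIm.
exact: cvg_cst.
Qed.

(** Fatou's lemma carries a bound on the L^2 distance to F over to an almost
    everywhere limit. *)
Lemma fatou_nsq (chi : T -> bool) (G : nat -> T -> C) (g F : T -> C) (B : R) :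
  measurable_fun setT chi -> {ae m, forall z, chi z} -> cmeasurable g ->
  (forall z, chi z ->
    (complex.Re (G k z) @[k --> \oo] --> complex.Re (g z)) /\
    (complex.Im (G k z) @[k --> \oo] --> complex.Im (g z))) ->
  (forall k, L2 (G k)) -> L2 F ->
  (\forall k \near \oo, nsq (fun z => G k z - F z) <= B) ->
  L2 g /\ nsq (fun z => g z - F z) <= B.
Proof.
move=> mchi aechi mg Gg LG LF GB.
pose h k z : \bar R := if chi z then (abs2 (G k z - F z))%:E else 0%E.
have h0 k z : (0 <= h k z)%E.
  by rewrite /h; case: ifP => // _; rewrite lee_fin abs2_ge0.
have mabs k : measurable_fun setT (fun z => (abs2 (G k z - F z))%:E).
  by apply/measurable_EFinP/measurable_abs2/L2_cmeasurable/L2B.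
have mh k : measurable_fun setT (h k) by apply: measurable_fun_ifT.
have mgF : cmeasurable (fun z => g z - F z).
  by apply: cmeasurableD => //; apply/L2_cmeasurable/L2N.
have mgF2 : measurable_fun setT (fun z => (abs2 (g z - F z))%:E).
  exact/measurable_EFinP/measurable_abs2.
have einf_cvg (u : nat -> \bar R) l : u k @[k --> \oo] --> l -> limn_einf u = l.
  move=> ul; rewrite is_cvg_limn_einfE; first exact/cvg_lim.
  by apply/cvg_ex; exists l.
have hcvg z : limn_einf (h ^~ z) =
    (if chi z then (abs2 (g z - F z))%:E else 0%E).
  rewrite /h; case: ifP => cz; last first.
    by apply: einf_cvg; exact: cvg_cst.
  have [cr ci] := Gg z cz.
  apply: einf_cvg; apply: cvg_EFin; first exact: nearW.
  rewrite /abs2/=; apply: cvgD; apply: cvgM => /=.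
  - by under eq_fun do rewrite cReD; rewrite cReD; apply: cvgD => //; exact: cvg_cst.
  - by under eq_fun do rewrite cReD; rewrite cReD; apply: cvgD => //; exact: cvg_cst.
  - by under eq_fun do rewrite cImD; rewrite cImD; apply: cvgD => //; exact: cvg_cst.
  - by under eq_fun do rewrite cImD; rewrite cImD; apply: cvgD => //; exact: cvg_cst.
have le1 : (\int[m]_z (abs2 (g z - F z))%:E <= B%:E)%E.
  have -> : (\int[m]_z (abs2 (g z - F z))%:E = \int[m]_z limn_einf (h ^~ z))%E.
    under [RHS]eq_integral do rewrite hcvg.
    apply: ae_eq_integral => //; first by apply: measurable_fun_ifT.
    by apply: filterS aechi => z -> _.
  apply: le_trans (fatou _ measurableT mh (fun k z _ => h0 k z)) _.
  have le2 : \forall k \near \oo, (\int[m]_z h k z <= B%:E)%E.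
    apply: filterS GB => k GkB.
    apply: (@le_trans _ _ (nsq (fun z => G k z - F z))%:E); last by rewrite lee_fin.
    rewrite EFin_nsq; last exact: L2B.
    apply: ge0_le_integral => // z _.
    by rewrite /h; case: ifP => // _; rewrite lee_fin abs2_ge0.
  rewrite limn_einf_lim; apply: lime_le; first exact: is_cvg_einfs.
  apply: filterS le2 => k; apply: le_trans.
  by apply: ereal_inf_lbound; exists k => /=.
have LgF : L2 (fun z => g z - F z).
  apply/L2P; split=> //; apply/integrableP; split=> //.
  under eq_integral do rewrite gee0_abs ?lee_fin ?abs2_ge0//.
  by apply: le_lt_trans le1 _; exact: ltry.
split.
  have -> : g = (fun z => (g z - F z) + F z) by apply/funext => z; rewrite subrK.
  exact: L2D.
by rewrite -lee_fin EFin_nsq.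
Qed.

End L2_completeness.

Section riesz_projection.
Variable R : realType.
Local Notation C := R[i].
Local Notation T := (circle R).
Implicit Types (f g h : T -> C) (c : nat -> C).

Definition tpoly c n : T -> C := fun z => \sum_(i < n) c i * ez i z.

Lemma tpolyS c n : tpoly c n.+1 = fun z => tpoly c n z + c n * ez n z.
Proof. by apply/funext => z; rewrite /tpoly big_ord_recr. Qed.

Lemma L2_tpoly c n : L2 (tpoly c n).
Proof. by apply: (@L2_sum _ n (fun i z => c i * ez i z)) => i; exact/L2Z/L2_ez. Qed.

Lemma ae_bounded_tpoly c n : ae_bounded (tpoly c n).
Proof.
apply: (@ae_bounded_sum _ n (fun i z => c i * ez i z)) => i.
by apply: ae_boundedM; [exact: ae_bounded_cst|exact: ae_bounded_ez].
Qed.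

Lemma inner_tpoly_ez c n (k : nat) :
  inner (tpoly c n) (ez k) = if (k < n)%N then c k else 0.
Proof.
elim: n => [|n IH].
  have -> : tpoly c 0 = cst 0 by apply/funext => z; rewrite /tpoly big_ord0.
  exact: inner0l.
have Lk := @L2_ez R k; have Ln := @L2_ez R n.
rewrite tpolyS innerDl// ?IH; [|exact: L2_tpoly|exact: L2Z].
rewrite innerZl// inner_ez eqz_nat ltnS.
by case: (ltngtP k n) => [kn|kn|->]; rewrite ?mulr0 ?mulr1 ?addr0 ?add0r.
Qed.

Lemma inner_tpoly_Negz c n k : inner (tpoly c n) (ez (Negz k)) = 0.
Proof.
have Lk := @L2_ez R (Negz k).
rewrite (@inner_suml _ n (fun i z => c i * ez i z))//; last first.
  by move=> i; exact/L2Z/L2_ez.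
by rewrite big1// => i _; rewrite innerZl ?inner_ez ?mulr0//; exact: L2_ez.
Qed.

Lemma inner_tpolyr f c n : L2 f ->
  (forall i : nat, (i < n)%N -> inner f (ez i) = 0) -> inner f (tpoly c n) = 0.
Proof.
move=> Lf f0; rewrite innerC ?(@inner_suml _ n (fun i z => c i * ez i z))//.
- rewrite big1 ?conjC0// => i _; rewrite innerZl//; last exact: L2_ez.
  by rewrite innerC ?f0 ?conjC0 ?mulr0//; exact: L2_ez.
- by move=> i; exact/L2Z/L2_ez.
- exact: L2_tpoly.
Qed.

(** Pythagoras for the orthonormal characters. *)
Lemma nsq_tpolyB c n j :
  nsq (fun z => tpoly c (n + j) z - tpoly c n z) = \sum_(n <= i < n + j) abs2 (c i).
Proof.
elim: j => [|j IH].
  rewrite addn0 big_geq//; under eq_fun do rewrite subrr.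
  apply: (@complexI R); rewrite -inner_nsq -/(cst 0 : T -> C).
  exact: inner0l.
rewrite addnS big_nat_recr ?leq_addr//= -IH tpolyS.
have -> : (fun z => tpoly c (n + j) z + c (n + j)%N * ez (n + j)%N z - tpoly c n z)
  = (fun z => (tpoly c (n + j) z - tpoly c n z) + c (n + j)%N * ez (n + j)%N z).
  by apply/funext => z; rewrite addrAC.
have Le := @L2_ez R (n + j)%N; have Ln := L2_tpoly c n.
have Lnj := L2_tpoly c (n + j); have LB := L2B Lnj Ln.
rewrite nsqD_orth//; last 2 first.
- exact: L2Z.
- by rewrite innerZr// innerBl// !inner_tpoly_ez ltnn ltnNge leq_addr subr0 mulr0.
by rewrite nsqZ// nsq_ez mulr1.
Qed.

Lemma nsq_tpoly c n : nsq (tpoly c n) = \sum_(i < n) abs2 (c i).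
Proof.
rewrite -(big_mkord xpredT (fun i => abs2 (c i))) -(nsq_tpolyB c 0 n).
by congr nsq; apply/funext => z; rewrite /tpoly big_ord0 subr0.
Qed.

Lemma eq0_of_abs2_le (w : C) (u : nat -> R) K : u n @[n --> \oo] --> 0 ->
  (\forall n \near \oo, abs2 w <= u n * K) -> w = 0.
Proof.
move=> u0 wu; have uK : u n * K @[n --> \oo] --> 0.
  by rewrite -[X in _ --> X](mul0r K); apply: cvgM => //; exact: cvg_cst.
apply: abs2_eq0; apply/eqP; rewrite eq_le abs2_ge0 andbT.
rewrite -(cvg_lim _ uK)//; apply: limr_ge => //.
by apply/cvg_ex; eexists; exact: uK.
Qed.

Lemma inner_L2lim (G : nat -> T -> C) f h (w : C) :
  (forall n, L2 (G n)) -> L2 f -> L2 h ->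
  nsq (fun z => f z - G n z) @[n --> \oo] --> 0 ->
  (\forall n \near \oo, inner (G n) h = w) -> inner f h = w.
Proof.
move=> LG Lf Lh fG Gw; apply/eqP; rewrite -subr_eq0; apply/eqP.
apply: (eq0_of_abs2_le (K := nsq h) fG); apply: filterS Gw => n <-.
by rewrite -innerBl//; apply: cauchy_schwarz => //; exact: L2B.
Qed.

(** The partial sums are Cauchy in L^2; along a subsequence whose increments
    decay geometrically they converge almost everywhere, and Fatou's lemma
    turns the pointwise limit into an L^2 limit of the whole sequence. *)
Lemma riesz_fischer c (B : R) : (forall n, nsq (tpoly c n) <= B) ->
  exists g, L2 g /\ nsq (fun z => g z - tpoly c n z) @[n --> \oo] --> 0.
Proof.
move=> cB.
pose s n := nsq (tpoly c n).
have sD n j : s (n + j)%N = s n + nsq (fun z => tpoly c (n + j) z - tpoly c n z).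
  rewrite nsq_tpolyB /s !nsq_tpoly -!(big_mkord xpredT (fun i => abs2 (c i))).
  by rewrite -big_cat_nat ?leq_addr.
have sn : {homo s : n k / (n <= k)%N >-> n <= k}.
  by move=> n k /subnKC <-; rewrite sD lerDl nsq_ge0.
have scv : cvgn s.
  by apply: nondecreasing_is_cvgn => //; exists B => _ [n _ <-]; exact: cB.
have sle n : s n <= limn s by exact: nondecreasing_cvgn_le.
have tail n k : (n <= k)%N ->
    nsq (fun z => tpoly c k z - tpoly c n z) <= limn s - s n.
  by move=> /subnKC <-; rewrite lerBrDl -sD.
have tail0 : limn s - s n @[n --> \oo] --> 0.
  by rewrite -[X in _ --> X](subrr (limn s)); apply: cvgB => //; exact: cvg_cst.
have ex k : exists N, forall n, (N <= n)%N -> limn s - s n <= (4^-1) ^+ k.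
  have e0 : 0 < (4^-1 : R) ^+ k by rewrite exprn_gt0.
  have /cvgrPdist_le/(_ _ e0)[N _ NP] := tail0; exists N => n Nn.
  have := NP n Nn; rewrite /= sub0r normrN; apply: le_trans; exact: ler_norm.
have {ex} [N NP] := choice ex.
pose M k := (\sum_(i < k.+1) (N i).+1)%N.
have MN k : (N k <= M k)%N by rewrite /M big_ord_recr/= (leq_trans (leqnSn _))// leq_addl.
have MS k : (M k <= M k.+1)%N by rewrite /M [leqRHS]big_ord_recr/= leq_addr.
have kM k : (k <= M k)%N.
  elim: k => // k IH; rewrite /M big_ord_recr/=.
  by apply: (leq_trans (_ : k.+1 <= M k + 1)%N); [rewrite addn1 ltnS|rewrite leq_add2l].
have LG k : L2 (tpoly c (M k)) by exact: L2_tpoly.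
have [k|chi [g [mchi aechi mg Gg]]] := L2_fast_cauchy_ae_cvg LG.
  exact: le_trans (tail _ _ (MS k)) (NP _ _ (MN k)).
have key n : L2 g /\ nsq (fun z => g z - tpoly c n z) <= limn s - s n.
  apply: (fatou_nsq mchi aechi mg Gg LG (L2_tpoly c n)).
  by exists n => // k /= nk; apply: tail; exact: leq_trans nk (kM k).
exists g; split; first by case: (key 0%N).
apply: (@squeeze_cvgr _ _ _ _ (fun=> 0) (fun n => limn s - s n)) => //.
- by apply: nearW => n; rewrite nsq_ge0/=; case: (key n).
- exact: cvg_cst.
Qed.

(** The difference between f and its partial sum is orthogonal to the partial
    sum. *)
Lemma bessel f n : L2 f -> nsq (tpoly (fun i => inner f (ez i)) n) <= nsq f.
Proof.
move=> Lf; set S := tpoly _ n; have LS : L2 S by exact: L2_tpoly.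
have LfS := L2B Lf LS.
have e : f = (fun z => (f z - S z) + S z) by apply/funext => z; rewrite subrK.
rewrite [in leRHS]e nsqD_orth//; first by rewrite lerDr nsq_ge0.
apply: inner_tpolyr => // i lin.
rewrite innerBl//; last exact: L2_ez.
by rewrite inner_tpoly_ez lin subrr.
Qed.

(** The Hardy space seen from the Fourier side, and its orthogonal complement. *)
Definition hardy f := L2 f /\ forall n : nat, inner f (@ez R (Negz n)) = 0.

Definition cohardy f := L2 f /\ forall n : nat, inner f (@ez R (Posz n)) = 0.

(** The orthogonal projection of f onto the Hardy space, obtained as the sum
    of the nonnegative half of the Fourier series. *)
Lemma riesz_projection f : L2 f -> exists g, [/\ hardy g,
  cohardy (fun z => f z - g z) &
  nsq (fun z => g z - tpoly (fun i => inner f (ez i)) n z) @[n --> \oo] --> 0].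
Proof.
move=> Lf; have [g [Lg gc]] := riesz_fischer (fun n => bessel n Lf).
have LS n := L2_tpoly (fun i => inner f (ez i)) n.
exists g; split=> //; split=> //.
- move=> n; apply: (inner_L2lim LS Lg (L2_ez _ _) gc).
  by apply: nearW => k; exact: inner_tpoly_Negz.
- exact: L2B.
- move=> n; rewrite innerBl//; last exact: L2_ez.
  apply/eqP; rewrite subr_eq0 eq_sym; apply/eqP.
  apply: (inner_L2lim LS Lg (L2_ez _ _) gc).
  by exists n.+1 => // k /= nk; rewrite inner_tpoly_ez nk.
Qed.

Lemma hardy_cohardy_eq0 f : hardy f -> cohardy f -> eq_ae f (cst 0).
Proof. by move=> [Lf f1] [_ f2]; apply: fourier_unique; split=> // -[]. Qed.

(** A function and its projection have the same Fourier coefficients, so that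
    f is the limit of its own partial sums. *)
Lemma hardy_approx f : hardy f ->
  nsq (fun z => f z - tpoly (fun i => inner f (ez i)) n z) @[n --> \oo] --> 0.
Proof.
move=> [Lf f0]; have [g [[Lg g0] [_ fg0] gc]] := riesz_projection Lf.
have LfB := L2B Lf Lg.
have fg : eq_ae (fun z => f z - g z) (cst 0).
  apply: hardy_cohardy_eq0; split=> // n.
  by rewrite innerBl ?f0 ?g0 ?subr0//; exact: L2_ez.
rewrite (_ : (fun n => _) =
  fun n => nsq (fun z => g z - tpoly (fun i => inner f (ez i)) n z))//.
apply/funext => n; have LS := L2_tpoly (fun i => inner f (ez i)) n.
apply: eq_nsq; try exact/L2_cmeasurable/L2B.
by apply: filterS fg => z /eqP; rewrite subr_eq0 => /eqP ->.
Qed.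

Lemma inner_hardy_cohardy f g : hardy f -> cohardy g -> inner f g = 0.
Proof.
move=> Hf [Lg g0]; have [Lf _] := Hf.
apply: (inner_L2lim (L2_tpoly _) Lf Lg (hardy_approx Hf)).
apply: nearW => n; rewrite innerC//; last exact: L2_tpoly.
by rewrite inner_tpolyr ?conjC0.
Qed.

Lemma inner_cohardy_hardy f g : cohardy f -> hardy g -> inner f g = 0.
Proof.
move=> Hf Hg; rewrite innerC; [|by case: Hg|by case: Hf].
by rewrite inner_hardy_cohardy ?conjC0.
Qed.

End riesz_projection.

(** * Boundary values of analytic functions *)

Section complex_limits.
Variable R : realType.
Local Notation C := R[i].
Implicit Types (u : nat -> C) (l : C).

(** The norm of R[i] takes complex values; squared moduli bring limits in R[i]
    back to limits in R. *)
Lemma cvg_complex_abs2 u l :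
  ((u n : C^o) @[n --> \oo] --> (l : C^o)) <->
  (abs2 (l - u n) @[n --> \oo] --> (0 : R)).
Proof.
split=> [/cvgrPdist_lt ul|ul]; last first.
  apply/cvgrPdist_lt => e e0.
  have [eR ei] : 0 < complex.Re e /\ complex.Im e = 0.
    by move: e0; rewrite ltcE/= => /andP[/eqP -> ->].
  have e20 : 0 < complex.Re e ^+ 2 by rewrite exprn_gt0.
  move/cvgrPdist_lt/(_ _ e20) : ul; apply: filterS => n.
  rewrite sub0r normrN ger0_norm ?abs2_ge0// norm_complexE => h.
  rewrite ltcE/= ei eqxx/= -(ger0_norm (ltW eR)) -sqrtr_sqr ltr_sqrt//.
apply/cvgrPdist_lt => e e0.
have e1 : 0 < (Num.sqrt e)%:C by rewrite ltcR sqrtr_gt0.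
apply: filterS (ul _ e1) => n; rewrite norm_complexE ltcR ltr_sqrt//.
by rewrite sub0r normrN ger0_norm ?abs2_ge0.
Qed.

Lemma cvg_abs2_Re_Im u l : abs2 (l - u n) @[n --> \oo] --> (0 : R) <->
  (complex.Re (u n) @[n --> \oo] --> complex.Re l) /\
  (complex.Im (u n) @[n --> \oo] --> complex.Im l).
Proof.
split=> [ul|[ur ui]].
  have aux (p : C -> R) : (forall n, (p l - p (u n)) ^+ 2 <= abs2 (l - u n)) ->
      p (u n) @[n --> \oo] --> p l.
    move=> pl; apply/cvgrPdist_lt => e e0.
    have e20 : 0 < e ^+ 2 by rewrite exprn_gt0.
    move/cvgrPdist_lt/(_ _ e20) : ul; apply: filterS => n.
    rewrite sub0r normrN ger0_norm ?abs2_ge0// => h.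
    rewrite -(ger0_norm (ltW e0)) -!sqrtr_sqr ltr_sqrt//.
    exact: le_lt_trans (pl n) h.
  split; apply: aux => n; rewrite /abs2 ?cReD ?cImD ?cReN ?cImN.
    by rewrite lerDl sqr_ge0.
  by rewrite lerDr sqr_ge0.
have -> : (fun n => abs2 (l - u n)) = fun n =>
    (complex.Re l - complex.Re (u n)) * (complex.Re l - complex.Re (u n)) +
    (complex.Im l - complex.Im (u n)) * (complex.Im l - complex.Im (u n)).
  by apply/funext => n; rewrite /abs2 cReD cImD cReN cImN !expr2.
have cr : complex.Re l - complex.Re (u n) @[n --> \oo] --> 0.
  by rewrite -[X in _ --> X](subrr (complex.Re l)); apply: cvgB => //; exact: cvg_cst.
have ci : complex.Im l - complex.Im (u n) @[n --> \oo] --> 0.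
  by rewrite -[X in _ --> X](subrr (complex.Im l)); apply: cvgB => //; exact: cvg_cst.
have -> : (0 : R) = 0 * 0 + 0 * 0 by rewrite mulr0 addr0.
by apply: cvgD; apply: cvgM.
Qed.

Lemma geometric_sum_le (x : R) n : 0 <= x < 1 ->
  \sum_(i < n) x ^+ i <= (1 - x)^-1.
Proof.
move=> /andP[x0 x1]; have y0 : 0 < 1 - x by rewrite subr_gt0.
rewrite -[leRHS]mul1r ler_pdivlMr//.
have -> : (\sum_(i < n) x ^+ i) * (1 - x) = 1 - x ^+ n.
  elim: n => [|n IH]; first by rewrite big_ord0 mul0r expr0 subrr.
  by rewrite big_ord_recr/= mulrDl IH exprS; ring.
by rewrite lerBlDr lerDl exprn_ge0.
Qed.

End complex_limits.

Section boundary_values.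
Variable R : realType.
Local Notation C := R[i].
Local Notation T := (circle R).
Implicit Types (f g : T -> C) (a : nat -> C) (F : C -> C) (r : R).

Definition power_series a F := forall z : C, `|z| < 1 ->
  series (fun n => a n * z ^+ n : C^o) @ \oo --> (F z : C^o).

Let dcoef a r : nat -> C := fun n => a n * (r%:C) ^+ n.

Lemma norm_dilate r (z : T) : 0 <= r < 1 -> `|r%:C * val z| < 1.
Proof.
move=> /andP[r0 r1]; rewrite norm_complexE abs2M abs2_real -/(zeta z) abs2_zeta.
by rewrite mulr1 sqrtr_sqr ger0_norm// (_ : 1 = 1%:C)// ltcR.
Qed.

Lemma dilate_cvg a F r (z : T) : power_series a F -> 0 <= r < 1 ->
  abs2 (dilate F r z - tpoly (dcoef a r) n z) @[n --> \oo] --> (0 : R).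
Proof.
move=> aF r01; have := aF _ (norm_dilate z r01).
move/cvg_complex_abs2; rewrite (_ : (fun n => _) = fun n =>
  abs2 (dilate F r z - tpoly (dcoef a r) n z))//.
apply/funext => n; congr (abs2 (_ - _)); rewrite /series/= big_mkord.
by apply: eq_bigr => i _; rewrite exprMn mulrA.
Qed.

(** Convergence at a radius between r and 1 bounds the coefficients by a
    geometric sequence. *)
Lemma nsq_dilate_bounded a F r : power_series a F -> 0 <= r < 1 ->
  exists B : R, forall n, nsq (tpoly (dcoef a r) n) <= B.
Proof.
move=> aF /andP[r0 r1]; pose s := (1 + r) / 2.
have s0 : 0 < s by rewrite /s; lra.
have s1 : s < 1 by rewrite /s; lra.
have rs : r < s by rewrite /s; lra.
have ns : `|s%:C| < 1 :> C.
  by rewrite norm_complexE abs2_real sqrtr_sqr gtr0_norm// (_ : 1 = 1%:C)// ltcR.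
have t0 : (a n * s%:C ^+ n : C^o) @[n --> \oo] --> (0 : C^o).
  by apply: cvg_series_cvg_0; apply/cvg_ex; eexists; exact: aF _ ns.
have [N _ NP] : \forall n \near \oo, abs2 (a n * s%:C ^+ n) <= 1.
  move/cvg_complex_abs2/cvgrPdist_le/(_ 1 ltr01) : t0; apply: filterS => n.
  by rewrite !sub0r normrN ger0_norm ?abs2_ge0// abs2N.
pose K := 1 + \sum_(i < N) abs2 (a i * s%:C ^+ i).
have Kn n : abs2 (a n * s%:C ^+ n) <= K.
  have [nN|Nn] := ltnP n N.
    rewrite /K (bigD1 (Ordinal nN))//= addrCA lerDl addr_ge0// sumr_ge0// => i _.
    exact: abs2_ge0.
  apply: le_trans (NP n Nn) _; rewrite lerDl sumr_ge0// => i _; exact: abs2_ge0.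
pose q := (r / s) ^+ 2.
have q01 : 0 <= q < 1.
  rewrite sqr_ge0/= expr_lt1//; last exact: divr_ge0 r0 (ltW s0).
  by rewrite ltr_pdivrMr// mul1r.
exists (K * (1 - q)^-1) => n; rewrite nsq_tpoly.
apply: le_trans (_ : K * \sum_(i < n) q ^+ i <= _); last first.
  rewrite ler_wpM2l ?geometric_sum_le//.
  by apply: le_trans (Kn 0%N); exact: abs2_ge0.
rewrite mulr_sumr; apply: ler_sum => i _.
have -> : abs2 (dcoef a r i) = abs2 (a i * s%:C ^+ i) * q ^+ i.
  rewrite /dcoef !abs2M !abs2X !abs2_real -mulrA -exprMn /q -exprMn.
  by rewrite mulrCA mulfV ?gt_eqF// mulr1.
by apply: ler_wpM2r (Kn i); case/andP : q01 => q0 _; exact: exprn_ge0.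
Qed.

(** The partial sums converge to the dilate pointwise, by analyticity, and to
    some limit in L^2, by Riesz-Fischer; Fatou's lemma identifies the two
    limits. *)
Lemma dilate_L2lim a F r : power_series a F -> 0 <= r < 1 ->
  L2 (dilate F r) /\
  nsq (fun z => dilate F r z - tpoly (dcoef a r) n z) @[n --> \oo] --> 0.
Proof.
move=> aF r01; have [B PB] := nsq_dilate_bounded aF r01.
have [g [Lg gc]] := riesz_fischer PB.
have LS n := L2_tpoly (dcoef a r) n.
have pc z : (complex.Re (tpoly (dcoef a r) n z) @[n --> \oo] -->
      complex.Re (dilate F r z)) /\
    (complex.Im (tpoly (dcoef a r) n z) @[n --> \oo] -->
      complex.Im (dilate F r z)).
  by apply/cvg_abs2_Re_Im; exact: dilate_cvg aF r01.
have mD : cmeasurable (dilate F r).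
  split.
    apply: (measurable_fun_cvg (h := fun n z => complex.Re (tpoly (dcoef a r) n z))).
      by move=> n; case: (L2_cmeasurable (LS n)).
    by move=> z _; case: (pc z).
  apply: (measurable_fun_cvg (h := fun n z => complex.Im (tpoly (dcoef a r) n z))).
    by move=> n; case: (L2_cmeasurable (LS n)).
  by move=> z _; case: (pc z).
have key e : 0 < e -> L2 (dilate F r) /\ nsq (fun z => dilate F r z - g z) <= e.
  move=> e0; apply: (@fatou_nsq _ (fun=> true) (tpoly (dcoef a r)) _ _ _ _ _ mD) => //.
    exact: aeW.
  move/cvgrPdist_le/(_ _ e0) : gc; apply: filterS => n.
  by rewrite sub0r normrN ger0_norm ?nsq_ge0// nsqBC.
have [LD _] := key 1 ltr01; split=> //.
have Dg : eq_ae (dilate F r) g.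
  have : nsq (fun z => dilate F r z - g z) = 0.
    apply/eqP; rewrite eq_le nsq_ge0 andbT; apply/ler_addgt0Pl => e e0.
    by rewrite addr0; case: (key e e0).
  move/(nsq_eq0 (L2B LD Lg)); apply: filterS => z /eqP.
  by rewrite subr_eq0 => /eqP.
rewrite (_ : (fun n => _) = fun n => nsq (fun z => g z - tpoly (dcoef a r) n z))//.
apply/funext => n; apply: eq_nsq; try exact/L2_cmeasurable/L2B.
by apply: filterS Dg => z ->.
Qed.

(** The dilates have no Fourier coefficient of negative index, and Fourier
    coefficients are continuous for the L^2 norm. *)
Lemma boundary_value_hardy F f : disc_analytic F -> boundary_value F f -> hardy f.
Proof.
move=> [a aF] [Lf Ff]; split=> // k.
have Le := @L2_ez R (Negz k).
have w0 r : 0 <= r < 1 -> inner (dilate F r) (ez (Negz k)) = 0.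
  move=> r01; have [LD Dc] := dilate_L2lim aF r01.
  apply: (inner_L2lim (L2_tpoly _) LD Le Dc).
  by apply: nearW => n; exact: inner_tpoly_Negz.
set w := inner f _.
have wle : \forall r \near (1 : R)^'-,
    ((Num.sqrt (abs2 w))%:E <= norm2 (fun z => (dilate F r z - f z)%R))%E.
  near=> r.
  have r01 : 0 <= r < 1.
    by apply/andP; split; [near: r; exact: nbhs_left_ge|near: r; exact: nbhs_left_lt].
  have [LD _] := dilate_L2lim aF r01.
  have LB := L2B LD Lf.
  rewrite norm2E// lee_fin ler_wsqrtr// -abs2N -[- w]add0r -(w0 r r01) -innerBl//.
  by apply: le_trans (cauchy_schwarz LB Le) _; rewrite nsq_ez mulr1.
have : ((Num.sqrt (abs2 w))%:E <= 0)%E.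
  rewrite -(cvg_lim _ Ff)//; apply: lime_ge => //.
  by apply/cvg_ex; eexists; exact: Ff.
rewrite lee_fin => sw; apply: abs2_eq0; apply/eqP; rewrite eq_le abs2_ge0 andbT.
by rewrite -[abs2 w]sqr_sqrtr ?abs2_ge0// (le_anti (introT andP (conj sw (sqrtr_ge0 _)))) expr0n.
Unshelve. all: by end_near. Qed.

Lemma Re_sum (u : nat -> C) n :
  complex.Re (\sum_(0 <= i < n) u i) = \sum_(0 <= i < n) complex.Re (u i).
Proof.
elim: n => [|n IH]; first by rewrite !big_geq.
by rewrite !big_nat_recr//= cReD IH.
Qed.

Lemma Im_sum (u : nat -> C) n :
  complex.Im (\sum_(0 <= i < n) u i) = \sum_(0 <= i < n) complex.Im (u i).
Proof.
elim: n => [|n IH]; first by rewrite !big_geq.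
by rewrite !big_nat_recr//= cImD IH.
Qed.

(** On the disc the series is dominated by a geometric one, so that its real
    and imaginary parts converge. *)
Lemma bounded_coef_power_series a (K : R) : (forall n, abs2 (a n) <= K) ->
  exists F, power_series a F.
Proof.
move=> aK; have K0 : 0 <= K by exact: le_trans (abs2_ge0 _) (aK 0%N).
have conv (p : C -> R) z : (forall w, p w ^+ 2 <= abs2 w) -> `|z| < 1 ->
    cvgn (series (fun n => p (a n * z ^+ n))).
  move=> pw; rewrite norm_complexE (_ : 1 = 1%:C)// ltcR; set x := Num.sqrt _ => x1.
  have x0 : 0 <= x by exact: sqrtr_ge0.
  apply: normed_cvg; apply: nondecreasing_is_cvgn.
    by apply: nondecreasing_series => k _ _; exact: normr_ge0.
  exists (Num.sqrt K * (1 - x)^-1) => _ [n _ <-].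
  rewrite (_ : [normed series _] n = \sum_(i < n) `|p (a i * z ^+ i)|); last first.
    by rewrite -(big_mkord xpredT (fun i => `|p (a i * z ^+ i)|)).
  apply: le_trans (_ : Num.sqrt K * \sum_(i < n) x ^+ i <= _); last first.
    by rewrite ler_wpM2l ?sqrtr_ge0// geometric_sum_le// x0.
  rewrite mulr_sumr; apply: ler_sum => i _.
  rewrite -sqrtr_sqr -[x ^+ i]ger0_norm ?exprn_ge0// -sqrtr_sqr -sqrtrM//.
  rewrite ler_wsqrtr//; apply: le_trans (pw _) _.
  rewrite abs2M abs2X -exprM mulnC exprM sqr_sqrtr ?abs2_ge0//.
  by rewrite ler_wpM2r// exprn_ge0// abs2_ge0.
exists (fun z => (limn (series (fun n => complex.Re (a n * z ^+ n))) +i*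
  limn (series (fun n => complex.Im (a n * z ^+ n))))%C) => z z1.
apply/cvg_complex_abs2/cvg_abs2_Re_Im; rewrite /series/=; split.
  under eq_fun do rewrite Re_sum.
  by apply: (conv (@complex.Re R)) => // w; rewrite lerDl sqr_ge0.
under eq_fun do rewrite Im_sum.
by apply: (conv (@complex.Im R)) => // w; rewrite lerDr sqr_ge0.
Qed.

Lemma nsq_tpoly_dcoefB_cvg a N :
  nsq (fun z => tpoly (dcoef a r) N z - tpoly a N z) @[r --> 1^'-] --> 0.
Proof.
have e r : nsq (fun z => tpoly (dcoef a r) N z - tpoly a N z) =
    \sum_(i < N) (abs2 (a i) * ((r ^+ i - 1) * (r ^+ i - 1))).
  have -> : (fun z => tpoly (dcoef a r) N z - tpoly a N z) =
      tpoly (fun i => a i * (r ^+ i - 1)%:C) N.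
    apply/funext => z; rewrite /tpoly -sumrB; apply: eq_bigr => i _.
    by rewrite /dcoef rmorphB rmorphXn/= rmorph1; ring.
  by rewrite nsq_tpoly; apply: eq_bigr => i _; rewrite abs2M abs2_real expr2.
under eq_fun do rewrite e.
have c n : (r ^+ n - 1) @[r --> (1 : R)^'-] --> (0 : R).
  rewrite -[X in _ --> X](subrr (1 ^+ n)) expr1n; apply: cvgB; last exact: cvg_cst.
  by apply: cvg_at_left_filter; rewrite -[X in _ --> X](expr1n _ n); exact: exprn_continuous.
pose G n r := \sum_(i < n) (abs2 (a i) * ((r ^+ i - 1) * (r ^+ i - 1))).
suff : forall n, G n r @[r --> 1^'-] --> 0 by exact.
elim=> [|n IH].
  have -> : G 0%N = cst 0 by apply/funext => r; rewrite /G big_ord0.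
  exact: cvg_cst.
have -> : G n.+1 = fun r => G n r + abs2 (a n) * ((r ^+ n - 1) * (r ^+ n - 1)).
  by apply/funext => r; rewrite /G big_ord_recr.
rewrite -[X in _ --> X]addr0; apply: cvgD => //.
rewrite -[X in _ --> X](mulr0 (abs2 (a n))); apply: cvgM; first exact: cvg_cst.
by rewrite -[X in _ --> X](mulr0 0); apply: cvgM.
Qed.

(** Dilation multiplies the n-th Fourier coefficient by r^n, hence is a
    contraction that converges to the identity on trigonometric polynomials. *)
Lemma hardy_H2 f : hardy f -> H2 f.
Proof.
move=> Hf; have [Lf f0] := Hf.
pose a := fun n : nat => inner f (ez n).
have aK n : abs2 (a n) <= nsq f.
  by have := cauchy_schwarz Lf (L2_ez R n); rewrite nsq_ez mulr1.
have [F aF] := bounded_coef_power_series aK.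
have Sf : nsq (fun z => f z - tpoly a n z) @[n --> \oo] --> 0 by exact: hardy_approx.
have dle r n k : 0 <= r < 1 -> (n <= k)%N ->
    nsq (fun z => tpoly (dcoef a r) k z - tpoly (dcoef a r) n z) <=
    nsq (fun z => tpoly a k z - tpoly a n z).
  move=> /andP[r0 r1] /subnKC <-; rewrite !nsq_tpolyB; apply: ler_sum => i _.
  rewrite abs2M abs2X abs2_real -exprM ler_piMr ?abs2_ge0// exprn_ile1 ?exprn_ge0//.
  exact: ltW.
have d0 r n : 0 <= r < 1 -> nsq (tpoly (dcoef a r) n) <= nsq f.
  move=> r01; apply: le_trans (bessel n Lf); have := dle r 0%N n r01 (leq0n n).
  rewrite /tpoly; under eq_fun do rewrite [X in _ - X]big_ord0 subr0.
  by under [in leRHS]eq_fun do rewrite [X in _ - X]big_ord0 subr0.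
have LSr r n := L2_tpoly (dcoef a r) n.
have LS n := L2_tpoly a n.
exists F; split; first by exists a.
  exists (Num.sqrt (2 + 2 * nsq f)) => r r01.
  have [LD Dc] := dilate_L2lim aF r01.
  rewrite norm2E// lee_fin ler_wsqrtr//.
  have [N _ NP] : \forall n \near \oo,
      nsq (fun z => dilate F r z - tpoly (dcoef a r) n z) <= 1.
    move/cvgrPdist_le/(_ 1 ltr01) : Dc; apply: filterS => n.
    by rewrite sub0r normrN ger0_norm ?nsq_ge0.
  have e : dilate F r = fun z => (dilate F r z - tpoly (dcoef a r) N z) +
      tpoly (dcoef a r) N z by apply/funext => z; rewrite subrK.
  rewrite e; apply: le_trans (nsqD_le (L2B LD (LSr r N)) (LSr r N)) _.
  by have := NP N (leqnn N); have := d0 r N r01; rewrite /=; lra.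
split=> //.
have small e : 0 < e -> \forall r \near (1 : R)^'-,
    nsq (fun z => dilate F r z - f z) <= e.
  (* the four differences below contribute at most 28 d *)
  move=> e0; pose d := e / 40.
  have dp : 0 < d by rewrite divr_gt0.
  have [N _ NP] : \forall n \near \oo, nsq (fun z => f z - tpoly a n z) <= d.
    move/cvgrPdist_le/(_ _ dp) : Sf; apply: filterS => n.
    by rewrite sub0r normrN ger0_norm ?nsq_ge0.
  have pr : \forall r \near (1 : R)^'-,
      nsq (fun z => tpoly (dcoef a r) N z - tpoly a N z) <= d.
    move/cvgrPdist_le/(_ _ dp) : (nsq_tpoly_dcoefB_cvg a N); apply: filterS => r.
    by rewrite sub0r normrN ger0_norm ?nsq_ge0.
  near=> r.
  have r01 : 0 <= r < 1.
    by apply/andP; split; [near: r; exact: nbhs_left_ge|near: r; exact: nbhs_left_lt].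
  have prr : nsq (fun z => tpoly (dcoef a r) N z - tpoly a N z) <= d by near: r.
  have [LD Dc] := dilate_L2lim aF r01.
  have [K0 _ KP] : \forall n \near \oo,
      nsq (fun z => dilate F r z - tpoly (dcoef a r) n z) <= d.
    move/cvgrPdist_le/(_ _ dp) : Dc; apply: filterS => n.
    by rewrite sub0r normrN ger0_norm ?nsq_ge0.
  pose K := maxn K0 N.
  have h1 : nsq (fun z => dilate F r z - tpoly (dcoef a r) K z) <= d.
    by apply: KP; rewrite /= leq_maxl.
  have h2 : nsq (fun z => tpoly a K z - tpoly a N z) <= 4 * d.
    have -> : (fun z => tpoly a K z - tpoly a N z) =
        fun z => (tpoly a K z - f z) + (f z - tpoly a N z).
      by apply/funext => z; rewrite addrA subrK.
    apply: le_trans (nsqD_le (L2B (LS K) Lf) (L2B Lf (LS N))) _.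
    rewrite nsqBC; have := NP K (leq_maxr _ _); have := NP N (leqnn _).
    by rewrite /=; lra.
  have h3 := le_trans (dle r N K r01 (leq_maxr _ _)) h2.
  have -> : (fun z => dilate F r z - f z) = fun z =>
      ((dilate F r z - tpoly (dcoef a r) K z) +
       (tpoly (dcoef a r) K z - tpoly (dcoef a r) N z)) +
      ((tpoly (dcoef a r) N z - tpoly a N z) + (tpoly a N z - f z)).
    by apply/funext => z; rewrite !addrA !subrK.
  have L1 := L2B LD (LSr r K); have L2' := L2B (LSr r K) (LSr r N).
  have L3 := L2B (LSr r N) (LS N); have L4 := L2B (LS N) Lf.
  apply: le_trans (nsqD_le (L2D L1 L2') (L2D L3 L4)) _.
  have := nsqD_le L1 L2'; have := nsqD_le L3 L4.
  have := NP N (leqnn N); rewrite /= nsqBC => h4.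
  have de : 40 * d = e by rewrite /d; field.
  by lra.
have near01 : \forall r \near (1 : R)^'-, 0 <= r < 1.
  near=> r.
  by apply/andP; split; [near: r; exact: nbhs_left_ge|near: r; exact: nbhs_left_lt].
apply/fine_cvgP; split.
  apply: filterS near01 => r r01; have [LD _] := dilate_L2lim aF r01.
  by rewrite norm2E//; exact: L2B.
apply/cvgrPdist_le => e e0.
have e20 : 0 < e ^+ 2 by rewrite exprn_gt0.
apply: filterS2 near01 (small _ e20) => r r01 re /=.
have [LD _] := dilate_L2lim aF r01.
rewrite norm2E; last exact: L2B.
by rewrite sub0r normrN ger0_norm ?sqrtr_ge0//= -[leRHS](ger0_norm (ltW e0)) -sqrtr_sqr ler_wsqrtr.
Unshelve. all: by end_near. Qed.

Lemma H2_hardy f : H2 f <-> hardy f.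
Proof.
split; last exact: hardy_H2.
by move=> [F [aF _ Ff]]; exact: boundary_value_hardy aF Ff.
Qed.

Lemma Hoo_hardy f : Hoo f -> hardy f.
Proof. by move=> [F [aF _ Ff]]; exact: boundary_value_hardy aF Ff. Qed.

End boundary_values.

(** * Multiplication by bounded Hardy functions *)

Section hardy_algebra.
Variable R : realType.
Local Notation C := R[i].
Local Notation T := (circle R).
Implicit Types (f g h u s : T -> C) (c : C).

Lemma hardy_L2 f : hardy f -> L2 f. Proof. by case. Qed.

Lemma cohardy_L2 f : cohardy f -> L2 f. Proof. by case. Qed.

Lemma hardyD f g : hardy f -> hardy g -> hardy (fun z => f z + g z).
Proof.
move=> [Lf f0] [Lg g0]; split=> [|n]; first exact: L2D.
by rewrite innerDl ?f0 ?g0 ?addr0//; exact: L2_ez.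
Qed.

Lemma hardyZ c f : hardy f -> hardy (fun z => c * f z).
Proof.
move=> [Lf f0]; split=> [|n]; first exact: L2Z.
by rewrite innerZl ?f0 ?mulr0//; exact: L2_ez.
Qed.

Lemma hardyB f g : hardy f -> hardy g -> hardy (fun z => f z - g z).
Proof.
by move=> Hf /(hardyZ (-1)) Hg; have := hardyD Hf Hg; under eq_fun do rewrite mulN1r.
Qed.

Lemma cohardyD f g : cohardy f -> cohardy g -> cohardy (fun z => f z + g z).
Proof.
move=> [Lf f0] [Lg g0]; split=> [|n]; first exact: L2D.
by rewrite innerDl ?f0 ?g0 ?addr0//; exact: L2_ez.
Qed.

Lemma cohardyZ c f : cohardy f -> cohardy (fun z => c * f z).
Proof.
move=> [Lf f0]; split=> [|n]; first exact: L2Z.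
by rewrite innerZl ?f0 ?mulr0//; exact: L2_ez.
Qed.

Lemma hardy_ez (n : nat) : hardy (@ez R n).
Proof. by split=> [|k]; [exact: L2_ez|rewrite inner_ez]. Qed.

Lemma hardy_tpoly (c : nat -> C) n : hardy (tpoly c n).
Proof. by split=> [|k]; [exact: L2_tpoly|exact: inner_tpoly_Negz]. Qed.

(** For n > 0, conj(u) z^(-n) is orthogonal to every z^k with k >= 0, because
    u has no coefficient of negative index. *)
Lemma hardyM u f : hardy u -> ae_bounded u -> hardy f ->
  hardy (fun z => u z * f z).
Proof.
move=> [Lu u0] bu Hf; have mu := L2_cmeasurable Lu.
split=> [|n]; first exact: L2M mu bu (hardy_L2 Hf).
rewrite inner_mull; apply: (inner_hardy_cohardy Hf); split=> [|k].
  exact: L2M (cmeasurable_conj mu) (ae_bounded_conj bu) (L2_ez _ _).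
rewrite inner_mull (_ : (fun z => _) = fun z => ez k z * u z); last first.
  by apply/funext => z; rewrite conjCK mulrC.
rewrite innerC; [|exact: L2_ezM|exact: L2_ez].
by rewrite inner_ezM (_ : Negz n - Posz k = Negz (n + k)) ?u0 ?conjC0// !NegzE; lia.
Qed.

Lemma cohardy_conjM u g : hardy u -> ae_bounded u -> cohardy g ->
  cohardy (fun z => (u z)^* * g z).
Proof.
move=> Hu bu Hg; have mu := L2_cmeasurable (hardy_L2 Hu).
split=> [|k].
  exact: L2M (cmeasurable_conj mu) (ae_bounded_conj bu) (cohardy_L2 Hg).
rewrite inner_mull; apply: (inner_cohardy_hardy Hg).
under eq_fun do rewrite conjCK.
exact: hardyM Hu bu (hardy_ez k).
Qed.

(** Both the complement of the Hardy space and its image under multiplication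
    by z lie in the conjugate of the Hardy space; the boolean selects which. *)
Lemma hardy_conj_ezM (j : bool) g : cohardy g ->
  hardy (fun z => (ez (Posz j) z * g z)^*).
Proof.
move=> [Lg g0]; split=> [|n]; first exact/L2_conj/L2_ezM.
rewrite inner_conj_ez; last exact: L2_ezM.
rewrite inner_ezM (_ : - Negz n - Posz j = Posz (n + ~~ j)) ?g0 ?conjC0//.
by rewrite NegzE; case: j => /=; lia.
Qed.

End hardy_algebra.

(** * Inner functions and model spaces *)

Section model_spaces.
Variable R : realType.
Local Notation C := R[i].
Local Notation T := (circle R).
Local Notation m := (circle_measure R).
Implicit Types (f g h u v s phi : T -> C) (c : C).

Lemma inner_function_abs2 u : inner_function u -> {ae m, forall z, abs2 (u z) = 1}.
Proof.
move=> [_]; apply: filterS => z; rewrite norm_complexE => -[] s1.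
by rewrite -[LHS]sqr_sqrtr ?abs2_ge0// s1 expr1n.
Qed.

Lemma inner_function_hardy u : inner_function u -> hardy u.
Proof. by case=> /Hoo_hardy. Qed.

Lemma inner_function_bounded u : inner_function u -> ae_bounded u.
Proof. by move/inner_function_abs2 => u1; exists 1; apply: filterS u1 => z ->. Qed.

Lemma unimodular_mulJ (w : C) : abs2 w = 1 -> w * w^* = 1.
Proof. by move=> w1; rewrite -abs2E w1. Qed.

Lemma inner_isometry u f g : inner_function u -> L2 f -> L2 g ->
  inner (fun z => u z * f z) (fun z => u z * g z) = inner f g.
Proof.
move=> iu Lf Lg; have mu := L2_cmeasurable (hardy_L2 (inner_function_hardy iu)).
have bu := inner_function_bounded iu.
have LJ := L2M (cmeasurable_conj mu) (ae_bounded_conj bu) (L2M mu bu Lg).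
rewrite inner_mull; apply: (eq_innerr LJ Lg Lf).
apply: filterS (inner_function_abs2 iu) => z /unimodular_mulJ e.
by rewrite mulrA [_^* * _]mulrC e mul1r.
Qed.

Lemma model_spaceP u f : model_space u f <->
  hardy f /\ forall h, hardy h -> inner f (fun z => u z * h z) = 0.
Proof.
split=> -[/H2_hardy Hf f0]; split=> // h.
  by move=> /H2_hardy; exact: f0.
by move=> /H2_hardy; exact: f0.
Qed.

Lemma model_spaceD u f g : inner_function u -> model_space u f ->
  model_space u g -> model_space u (fun z => f z + g z).
Proof.
move=> iu /model_spaceP[Hf f0] /model_spaceP[Hg g0]; apply/model_spaceP.
split=> [|h Hh]; first exact: hardyD.
have Huh := hardyM (inner_function_hardy iu) (inner_function_bounded iu) Hh.
by rewrite innerDl ?f0 ?g0 ?addr0//; exact: hardy_L2.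
Qed.

Lemma model_spaceZ u c f : inner_function u -> model_space u f ->
  model_space u (fun z => c * f z).
Proof.
move=> iu /model_spaceP[Hf f0]; apply/model_spaceP.
split=> [|h Hh]; first exact: hardyZ.
have Huh := hardyM (inner_function_hardy iu) (inner_function_bounded iu) Hh.
by rewrite innerZl ?f0 ?mulr0//; exact: hardy_L2.
Qed.

(** K_u is the intersection of H^2 with u times the complement of H^2. *)
Lemma model_space_cohardy u f s : inner_function u -> hardy f -> cohardy s ->
  eq_ae f (fun z => u z * s z) -> model_space u f.
Proof.
move=> iu Hf Hs fs; apply/model_spaceP; split=> // h Hh.
have Hu := inner_function_hardy iu; have bu := inner_function_bounded iu.
have mu := L2_cmeasurable (hardy_L2 Hu).
have Luh := hardy_L2 (hardyM Hu bu Hh).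
rewrite (eq_innerl (hardy_L2 Hf) (L2M mu bu (cohardy_L2 Hs)) Luh fs).
rewrite inner_isometry//; [exact: inner_cohardy_hardy|exact: cohardy_L2|exact: hardy_L2].
Qed.

(** The image of z^n under the Toeplitz operator of symbol conj(u), that is, the
    projection of conj(u) z^n onto H^2; it is a polynomial because only finitely many
    Fourier coefficients of conj(u) have index at least -n. *)
Definition toeplitz_poly u n : T -> C :=
  tpoly (fun j => (inner u (ez (Posz (n - j)%N)))^*) n.+1.

(** The projection of z^n onto K_u. *)
Definition model_proj u n : T -> C :=
  fun z => ez (Posz n) z - u z * toeplitz_poly u n z.

Lemma cohardy_model_proj u (n : nat) : inner_function u ->
  cohardy (fun z => (u z)^* * ez n z - toeplitz_poly u n z).
Proof.
move=> iu; have Hu := inner_function_hardy iu; have [Lu u0] := Hu.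
have bu := inner_function_bounded iu.
have mu := L2_cmeasurable Lu; have Len := @L2_ez R n.
have L1 := L2M (cmeasurable_conj mu) (ae_bounded_conj bu) Len.
have L2 := L2_tpoly (fun j => (inner u (ez (Posz (n - j)%N)))^*) n.+1.
split=> [|k]; first exact: L2B.
have Lek := @L2_ez R k.
rewrite innerBl// inner_tpoly_ez inner_mull.
rewrite (_ : (fun z => _) = fun z => ez k z * u z); last first.
  by apply/funext => z; rewrite conjCK mulrC.
rewrite innerC//; last exact: L2_ezM.
rewrite inner_ezM ltnS; case: leqP => kn; first by rewrite subzn// subrr.
rewrite (_ : Posz n - Posz k = Negz (k - n).-1) ?u0 ?conjC0 ?subrr//.
by rewrite NegzE; lia.
Qed.

Lemma model_space_proj u n : inner_function u -> model_space u (model_proj u n).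
Proof.
move=> iu; have Hu := inner_function_hardy iu.
have bu := inner_function_bounded iu.
apply: (model_space_cohardy iu) (cohardy_model_proj n iu) _.
  by apply: hardyB; [exact: hardy_ez|apply: hardyM => //; exact: hardy_tpoly].
apply: filterS (inner_function_abs2 iu) => z /unimodular_mulJ e.
by rewrite /model_proj mulrBr mulrA e mul1r.
Qed.

Lemma ae_bounded_model_proj u n : inner_function u -> ae_bounded (model_proj u n).
Proof.
move=> iu; apply: ae_boundedD; first exact: ae_bounded_ez.
have -> : (fun z => - (u z * toeplitz_poly u n z)) =
    fun z => -1 * (u z * toeplitz_poly u n z).
  by apply/funext => z; rewrite mulN1r.
apply: ae_boundedM; first exact: ae_bounded_cst.
by apply: ae_boundedM; [exact: inner_function_bounded|exact: ae_bounded_tpoly].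
Qed.

Let a0 u : C := inner u (ez 0).

Lemma model_proj0 u z : model_proj u 0 z = 1 - (a0 u)^* * u z.
Proof.
by rewrite /model_proj /toeplitz_poly /tpoly big_ord_recr big_ord0/= add0r
  subnn ez0 mulr1 mulrC.
Qed.

Lemma inner_function_sub_cst u : inner_function u ->
  nsq (fun z => u z - a0 u * ez 0 z) = 1 - abs2 (a0 u).
Proof.
move=> iu; have Lu := hardy_L2 (inner_function_hardy iu).
have Le := @L2_ez R 0; have Lae := L2Z (a0 u) Le; have LB := L2B Lu Lae.
have <- : nsq u = 1.
  rewrite -(nsq_ez R 0) /nsq; congr fine; apply: ae_eq_integral => //;
    try by apply/measurable_EFinP/measurable_abs2/L2_cmeasurable.
  by apply: filterS (inner_function_abs2 iu) => z -> _; rewrite abs2_ez.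
have e : u = fun z => (u z - a0 u * ez 0 z) + a0 u * ez 0 z.
  by apply/funext => z; rewrite subrK.
have -> : nsq u = nsq (fun z => u z - a0 u * ez 0 z) + nsq (fun z => a0 u * ez 0 z).
  rewrite [X in nsq X = _]e nsqD_orth//.
  by rewrite innerZr// innerBl// innerZl// inner_ez eqxx mulr1 subrr mulr0.
by rewrite nsqZ// nsq_ez mulr1 addrK.
Qed.

Lemma nonconstant_coef0 u : inner_function u -> nonconstant u ->
  1 - abs2 (a0 u) != 0.
Proof.
move=> iu nu; apply/negP => /eqP; rewrite -inner_function_sub_cst// => u0.
have Lu := hardy_L2 (inner_function_hardy iu).
apply: (nu (a0 u)); have := nsq_eq0 (L2B Lu (L2Z (a0 u) (L2_ez R 0))) u0.
by apply: filterS => z /eqP; rewrite subr_eq0 ez0 mulr1 => /eqP.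
Qed.

(** This is S^* u, the image of P_u 1 under the conjugation f |-> u conj(z f)
    of K_u. *)
Definition backward_shift u : T -> C := fun z => ez (-1) z * (u z - a0 u * ez 0 z).

Lemma model_space_backward_shift u : inner_function u ->
  model_space u (backward_shift u).
Proof.
move=> iu; have Hu := inner_function_hardy iu; have [Lu u0] := Hu.
have bu := inner_function_bounded iu.
have He : cohardy (@ez R (-1)).
  by split=> [|k]; [exact: L2_ez|rewrite inner_ez].
have Hf : hardy (backward_shift u).
  have Lae := L2Z (a0 u) (L2_ez R 0); have LB := L2B Lu Lae.
  split=> [|n]; first exact: L2_ezM.
  have Ln := @L2_ez R (Negz n - -1).
  rewrite inner_ezM (innerBl Lu Lae Ln) (innerZl _ (L2_ez R 0) Ln) inner_ez.
  case: n Ln => [|n] Ln; first by rewrite (_ : Negz 0 - -1 = 0)// eqxx mulr1 subrr.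
  by rewrite (_ : Negz n.+1 - -1 = Negz n)// ?u0 ?mulr0 ?subr0// !NegzE; lia.
have Hs := cohardyD He (cohardyZ (- a0 u) (cohardy_conjM Hu bu He)).
apply: (model_space_cohardy iu Hf Hs).
apply: filterS (inner_function_abs2 iu) => z /unimodular_mulJ e.
rewrite /backward_shift ez0 mulr1.
transitivity (u z * ez (-1) z - a0 u * (u z * (u z)^*) * ez (-1) z); last by ring.
by rewrite e; ring.
Qed.

Lemma ae_bounded_backward_shift u : inner_function u ->
  ae_bounded (backward_shift u).
Proof.
move=> iu; apply: ae_boundedM; first exact: ae_bounded_ez.
apply: ae_boundedD; first exact: inner_function_bounded.
have -> : (fun z : T => - (a0 u * ez 0 z)) = fun=> - a0 u.
  by apply/funext => z; rewrite ez0 mulr1.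
exact: ae_bounded_cst.
Qed.

(** P_u 1 and the backward shift of u are bounded elements of K_u. Since this
    combination of them, with coefficients 1 and conj(a) z, is a nonzero constant,
    any information on phi P_u 1 and phi S^* u becomes information on phi. *)
Lemma model_test_functions u z :
  model_proj u 0 z + (a0 u)^* * (ez 1 z * backward_shift u z) =
  (1 - abs2 (a0 u))%:C.
Proof.
rewrite model_proj0 /backward_shift mulrA -ezD subrr ez0 !mul1r mulr1.
by rewrite rmorphB rmorph1/= abs2E; ring.
Qed.

(** L^2 is the orthogonal sum of u H^2, K_u and the complement of H^2. The
    component rho of F in K_u is orthogonal to every z^n = P_u z^n + u q_n: to the
    first summand by hypothesis on F, to the second as an element of K_u. *)
Lemma orth_bounded_model_space u F : inner_function u -> L2 F ->
  (forall f, model_space u f -> ae_bounded f -> inner F f = 0) ->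
  exists G s, [/\ hardy G, cohardy s & eq_ae F (fun z => u z * G z + s z)].
Proof.
move=> iu LF F0.
have Hu := inner_function_hardy iu; have bu := inner_function_bounded iu.
have mu := L2_cmeasurable (hardy_L2 Hu).
have [Fp [HFp HFm _]] := riesz_projection LF.
have LuFp : L2 (fun z => (u z)^* * Fp z).
  exact: L2M (cmeasurable_conj mu) (ae_bounded_conj bu) (hardy_L2 HFp).
have [G [HG Hs _]] := riesz_projection LuFp.
pose s z := (u z)^* * Fp z - G z.
pose rho z := Fp z - u z * G z.
have HuG := hardyM Hu bu HG.
have Hrho : hardy rho by exact: hardyB.
have Lrho := hardy_L2 Hrho.
have rhoE : eq_ae rho (fun z => u z * s z).
  apply: filterS (inner_function_abs2 iu) => z /unimodular_mulJ e.
  by rewrite /rho /s mulrBr mulrA e mul1r.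
have Lus : L2 (fun z => u z * s z) by exact: L2M mu bu (cohardy_L2 Hs).
have rho0 : eq_ae rho (cst 0).
  apply: hardy_cohardy_eq0 => //; split=> // n.
  have Mn := model_space_proj n iu; have Bn := ae_bounded_model_proj n iu.
  have /model_spaceP[Hfn fn0] := Mn; have Lfn := hardy_L2 Hfn.
  have Hq : hardy (toeplitz_poly u n) by exact: hardy_tpoly.
  have Huq := hardyM Hu bu Hq.
  have -> : ez n = fun z => model_proj u n z + u z * toeplitz_poly u n z.
    by apply/funext => z; rewrite /model_proj subrK.
  rewrite (innerDr Lfn (hardy_L2 Huq) Lrho).
  rewrite (eq_innerl Lrho Lus (hardy_L2 Huq) rhoE).
  rewrite (inner_isometry iu (cohardy_L2 Hs) (hardy_L2 Hq)).
  rewrite (inner_cohardy_hardy Hs Hq) addr0.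
  have -> : rho = fun z => F z - (F z - Fp z) - u z * G z.
    by apply/funext => z; rewrite opprB addrCA subrr addr0.
  have LFm := cohardy_L2 HFm; have LuG := hardy_L2 HuG.
  rewrite (innerBl (L2B LF LFm) LuG Lfn) (innerBl LF LFm Lfn) (F0 _ Mn Bn).
  rewrite (inner_cohardy_hardy HFm Hfn) subrr sub0r.
  by rewrite (innerC Lfn LuG) (fn0 _ HG) conjC0 oppr0.
exists G, (fun z => F z - Fp z); split=> //.
by apply: filterS rho0 => z /eqP; rewrite subr_eq0 => /eqP e; rewrite -e addrC subrK.
Qed.

(** The hypothesis puts phi f in v H^2 + conj(z H^2) for every bounded f in K_u.
    Combining this for f = P_u 1 and f = S^* u, the latter multiplied by z,
    gives a nonzero multiple of phi. *)
Lemma symbol_decomposition u v phi : inner_function u -> nonconstant u ->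
  inner_function v -> L2 phi ->
  (forall f g, model_space u f -> ae_bounded f -> model_space v g ->
    ae_bounded g -> inner (fun z => phi z * f z) g = 0) ->
  exists h k, [/\ hardy h, hardy k &
    eq_ae phi (fun z => v z * h z + (k z)^*)].
Proof.
move=> iu nu iv Lphi phi0.
have LM f : model_space u f -> ae_bounded f -> L2 (fun z => phi z * f z).
  move=> /model_spaceP[Hf _] bf; under eq_fun do rewrite mulrC.
  exact: L2M (L2_cmeasurable (hardy_L2 Hf)) bf Lphi.
have M0 := model_space_proj 0 iu; have B0 := ae_bounded_model_proj 0 iu.
have M1 := model_space_backward_shift iu; have B1 := ae_bounded_backward_shift iu.
have [G0 [s0 [HG0 Hs0 e0]]] := orth_bounded_model_space iv (LM _ M0 B0)
  (fun g Mg Bg => phi0 _ g M0 B0 Mg Bg).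
have [G1 [s1 [HG1 Hs1 e1]]] := orth_bounded_model_space iv (LM _ M1 B1)
  (fun g Mg Bg => phi0 _ g M1 B1 Mg Bg).
have := nonconstant_coef0 iu nu; set d := 1 - _ => d0.
pose a := a0 u.
exists (fun z => (d^-1)%:C * (G0 z + a^* * (ez 1 z * G1 z))).
exists (fun z => (d^-1)%:C * ((ez 0 z * s0 z)^* + a * (ez 1 z * s1 z)^*)).
have bez k := @ae_bounded_ez R k.
split.
- exact: (hardyZ _ (hardyD HG0 (hardyZ _ (hardyM (hardy_ez R 1) (bez 1) HG1)))).
- exact: (hardyZ _ (hardyD (hardy_conj_ezM false Hs0)
    (hardyZ _ (hardy_conj_ezM true Hs1)))).
have dd : (d^-1)%:C * d%:C = 1 by rewrite -rmorphM/= mulVf.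
apply: filterS2 e0 e1 => z h0 h1.
have -> : phi z = (d^-1)%:C *
    (phi z * model_proj u 0 z + a^* * (ez 1 z * (phi z * backward_shift u z))).
  have := model_test_functions u z; rewrite -/d -/a => e.
  have -> : phi z * model_proj u 0 z + a^* * (ez 1 z * (phi z * backward_shift u z))
    = phi z * d%:C by rewrite -e; ring.
  by rewrite mulrCA dd mulr1.
rewrite h0 h1 !(rmorphM, rmorphD)/= !conjCK ez0.
have -> : ((d^-1)%:C)^* = (d^-1)%:C by apply: complex_eqP; rewrite /= ?oppr0.
by ring.
Qed.

End model_spaces.

(** * Vanishing asymmetric truncated Toeplitz operators *)

Section vanishing_operator.
Variable R : realType.
Local Notation C := R[i].
Local Notation T := (circle R).
Implicit Types (f g h k : T -> C).
Variables (alpha theta : T -> C).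
Hypothesis ialpha : inner_function alpha.
Hypothesis itheta : inner_function theta.
Hypothesis alphatheta : inner_divides alpha theta.

(** theta H^2 is contained in alpha H^2, since theta / alpha is inner. *)
Lemma model_space_divides f : model_space alpha f -> model_space theta f.
Proof.
move=> /model_spaceP[Hf f0]; apply/model_spaceP; split=> // h Hh.
pose beta z := (alpha z)^* * theta z.
have ibeta : inner_function beta by [].
have Hbh := hardyM (inner_function_hardy ibeta) (inner_function_bounded ibeta) Hh.
have Hth := hardyM (inner_function_hardy itheta) (inner_function_bounded itheta) Hh.
have Habh := hardyM (inner_function_hardy ialpha) (inner_function_bounded ialpha) Hbh.
rewrite -[RHS](f0 _ Hbh); apply: (eq_innerr (hardy_L2 Hth) (hardy_L2 Habh) (hardy_L2 Hf)).
apply: filterS (inner_function_abs2 ialpha) => z /unimodular_mulJ e.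
by rewrite /beta !mulrA e mul1r.
Qed.

(** The inner product of conj(theta k) f with z^n is that of f with
    theta k z^n, and f is orthogonal to theta H^2. *)
Lemma cohardy_conj_symbol f k : model_space theta f -> ae_bounded f -> hardy k ->
  cohardy (fun z => (theta z * k z)^* * f z).
Proof.
move=> /model_spaceP[Hf f0] bf Hk.
have Htk := hardyM (inner_function_hardy itheta) (inner_function_bounded itheta) Hk.
split=> [|n].
  under eq_fun do rewrite mulrC.
  exact: L2M (L2_cmeasurable (hardy_L2 Hf)) bf (L2_conj (hardy_L2 Htk)).
rewrite inner_mull (_ : (fun z => _) = fun z => theta z * (ez n z * k z)).
  by apply: f0; exact: hardyM (hardy_ez R n) (@ae_bounded_ez R n) Hk.
by apply/funext => z; rewrite conjCK mulrAC mulrA.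
Qed.

Lemma inner_analytic_symbol f g h : hardy f -> ae_bounded f ->
  model_space alpha g -> hardy h -> inner (fun z => alpha z * h z * f z) g = 0.
Proof.
move=> Hf bf /model_spaceP[Hg g0] Hh.
have Hfh := hardyM Hf bf Hh.
have Hafh := hardyM (inner_function_hardy ialpha) (inner_function_bounded ialpha) Hfh.
have -> : (fun z => alpha z * h z * f z) = fun z => alpha z * (f z * h z).
  by apply/funext => z; rewrite -mulrA [h z * _]mulrC.
by rewrite innerC ?g0 ?conjC0//; exact: hardy_L2.
Qed.

(** The Fourier coefficients of negative index of w vanish because w is in H^2,
    those of positive index because conj(w) is. *)
Lemma hardy_conj_hardy_cst w g : hardy w -> hardy g ->
  eq_ae w (fun z => (g z)^*) -> exists c, eq_ae w (fun=> c).
Proof.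
move=> [Lw w0] [Lg g0] wg; exists (inner w (ez 0)).
have Lc : L2 (fun z => inner w (ez 0) * ez 0 z) by exact/L2Z/L2_ez.
have : eq_ae (fun z => w z - inner w (ez 0) * ez 0 z) (cst 0).
  apply: fourier_unique; split=> [|k]; first exact: L2B.
  have Lk := @L2_ez R k.
  rewrite innerBl// innerZl ?inner_ez//; last exact: L2_ez.
  case: k Lk => [[|n]|n] Lk; first by rewrite eqxx mulr1 subrr.
    rewrite (eq_innerl Lw (L2_conj Lg) Lk wg) inner_conj_ez//.
    by rewrite -NegzE g0 conjC0 mulr0 subr0.
  by rewrite w0 mulr0 subr0.
by apply: filterS => z /eqP; rewrite subr_eq0 ez0 mulr1 => /eqP.
Qed.

(** Applied to phi on K_theta and to conj(phi) on K_alpha,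
    symbol_decomposition gives phi = alpha h1 + conj(k1) and phi = h2 +
    conj(theta k2). The difference alpha h1 - h2 is then in H^2 together with
    its conjugate, hence is a constant c, and phi = alpha h1 + conj(theta k2)
    - c. Testing on P_alpha 1, which is in K_alpha and thus in K_theta, forces
    c = 0. *)
Lemma vanishing_form_symbol phi : nonconstant alpha -> nonconstant theta ->
  L2 phi ->
  (forall f g, model_space theta f -> ae_bounded f -> model_space alpha g ->
    ae_bounded g -> inner (fun z => phi z * f z) g = 0) ->
  exists h k, [/\ hardy h, hardy k &
    eq_ae phi (fun z => alpha z * h z + (theta z * k z)^*)].
Proof.
move=> nalpha ntheta Lphi phi0.
have Halpha := inner_function_hardy ialpha; have balpha := inner_function_bounded ialpha.
have Htheta := inner_function_hardy itheta; have btheta := inner_function_bounded itheta.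
have [h1 [k1 [Hh1 Hk1 e1]]] := symbol_decomposition itheta ntheta ialpha Lphi phi0.
have phiJ0 g f : model_space alpha g -> ae_bounded g -> model_space theta f ->
    ae_bounded f -> inner (fun z => (phi z)^* * g z) f = 0.
  move=> Mg Bg Mf Bf; have /model_spaceP[Hg _] := Mg; have /model_spaceP[Hf _] := Mf.
  have Lphig : L2 (fun z => (phi z)^* * g z).
    under eq_fun do rewrite mulrC.
    exact: L2M (L2_cmeasurable (hardy_L2 Hg)) Bg (L2_conj Lphi).
  rewrite innerC; [|exact: hardy_L2|exact: Lphig].
  rewrite (_ : inner _ _ = 0) ?conjC0//.
  rewrite -[RHS](phi0 f g Mf Bf Mg Bg) [RHS]inner_mull.
  by [].
have [k2 [h2 [Hk2 Hh2 e2]]] :=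
  symbol_decomposition ialpha nalpha itheta (L2_conj Lphi) phiJ0.
have Hah1 := hardyM Halpha balpha Hh1; have Htk2 := hardyM Htheta btheta Hk2.
have [c wc] : exists c, eq_ae (fun z => alpha z * h1 z - h2 z) (fun=> c).
  apply: (hardy_conj_hardy_cst (g := fun z => theta z * k2 z - k1 z)).
  - exact: hardyB.
  - exact: hardyB.
  - apply: filterS2 e1 e2 => z h1' h2'.
    move/(congr1 (fun w => w^*)) : h2'; rewrite conjCK rmorphD/= conjCK h1' => e.
    rewrite rmorphB/=; apply/eqP; rewrite subr_eq addrAC -e.
    by apply/eqP; ring.
have phiE : eq_ae phi (fun z => alpha z * h1 z + (theta z * k2 z)^* - c).
  apply: filterS2 e2 wc => z h2' <-.
  move/(congr1 (fun w => w^*)) : h2'; rewrite conjCK rmorphD/= conjCK => ->.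
  by ring.
suff c0 : c = 0.
  exists h1, k2; split=> //; apply: filterS phiE => z ->; rewrite c0 subr0//.
pose g0 := model_proj alpha 0.
have Mg := model_space_proj 0 ialpha; have Bg := ae_bounded_model_proj 0 ialpha.
rewrite -/g0 in Mg Bg.
have Mg' := model_space_divides Mg; have /model_spaceP[Hg g00] := Mg.
have Lg := hardy_L2 Hg.
have Hcohardy := cohardy_conj_symbol Mg' Bg Hk2.
have La : L2 (fun z => alpha z * h1 z * g0 z).
  under eq_fun do rewrite mulrC.
  exact: L2M (L2_cmeasurable Lg) Bg (hardy_L2 Hah1).
have Lt := cohardy_L2 Hcohardy; have Lc := L2Z c Lg.
have Lphig : L2 (fun z => phi z * g0 z).
  under eq_fun do rewrite mulrC.
  exact: L2M (L2_cmeasurable Lg) Bg Lphi.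
have := phi0 g0 g0 Mg' Bg Mg Bg.
have Ls := L2D La Lt; have Lsc := L2B Ls Lc.
have phig : eq_ae (fun z => phi z * g0 z) (fun z => (alpha z * h1 z * g0 z +
    (theta z * k2 z)^* * g0 z) - c * g0 z).
  by apply: filterS phiE => z ->; ring.
rewrite (eq_innerl Lphig Lsc Lg phig) (innerBl Ls Lc Lg) (innerDl La Lt Lg).
rewrite (innerZl c Lg Lg) (inner_analytic_symbol Hg Bg Mg Hh1).
rewrite (inner_cohardy_hardy Hcohardy Hg) addr0 sub0r.
have -> : inner g0 g0 = 1 - (inner alpha (ez 0))^* * inner alpha (ez 0).
  have g0E : g0 = fun z => ez 0 z - alpha z * ((inner alpha (ez 0))^* * ez 0 z).
    by apply/funext => z; rewrite /g0 model_proj0 ez0 mulr1 mulrC.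
  have He0 := hardyZ (inner alpha (ez 0))^* (hardy_ez R 0).
  have Haz := hardyM Halpha balpha He0.
  rewrite [X in inner _ X]g0E innerBr//; [|exact: L2_ez|exact: hardy_L2].
  rewrite g00// subr0 g0E innerBl; [|exact: L2_ez|exact: hardy_L2|exact: L2_ez].
  rewrite inner_ez eqxx; congr (_ - _).
  have -> : (fun z => alpha z * ((inner alpha (ez 0))^* * ez 0 z)) =
      fun z => (inner alpha (ez 0))^* * alpha z.
    by apply/funext => z; rewrite ez0 mulr1 mulrC.
  by rewrite innerZl//; [exact: hardy_L2|exact: L2_ez].
move=> /eqP; rewrite oppr_eq0 mulf_eq0 => /orP[/eqP //|/eqP d0].
have := nonconstant_coef0 ialpha nalpha.
by rewrite -(inj_eq (@complexI R)) rmorphB rmorph1/= abs2E [_ * _^*]mulrC d0 eqxx.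
Qed.

(** For bounded f, A f = P_alpha(phi f), and both summands of phi f are
    orthogonal to K_alpha. *)
Lemma atto_bounded_eq0 phi (A : (T -> C) -> (T -> C)) h k f : L2 phi ->
  bounded_atto theta alpha phi A -> hardy h -> hardy k ->
  eq_ae phi (fun z => alpha z * h z + (theta z * k z)^*) ->
  model_space theta f -> ae_bounded f -> eq_ae (A f) (cst 0).
Proof.
move=> Lphi [_ Aproj] Hh Hk phiE Mf Bf.
have /model_spaceP[Hf _] := Mf; have Lf := hardy_L2 Hf.
have Lphif : L2 (fun z => phi z * f z).
  under eq_fun do rewrite mulrC.
  exact: L2M (L2_cmeasurable Lf) Bf Lphi.
have [MAf Af0] := Aproj f Mf Lphif.
have /model_spaceP[HAf _] := MAf; have LAf := hardy_L2 HAf.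
have Hah := hardyM (inner_function_hardy ialpha) (inner_function_bounded ialpha) Hh.
have La : L2 (fun z => alpha z * h z * f z).
  under eq_fun do rewrite mulrC.
  exact: L2M (L2_cmeasurable Lf) Bf (hardy_L2 Hah).
have Hc := cohardy_conj_symbol Mf Bf Hk; have Lc := cohardy_L2 Hc.
apply: (nsq_eq0 LAf); apply: (@complexI R); rewrite -inner_nsq.
have := Af0 (A f) MAf; rewrite innerBl// => /eqP; rewrite subr_eq0 => /eqP <-.
have phif : eq_ae (fun z => phi z * f z)
    (fun z => alpha z * h z * f z + (theta z * k z)^* * f z).
  by apply: filterS phiE => z ->; ring.
rewrite (eq_innerl Lphif (L2D La Lc) LAf phif) (innerDl La Lc LAf).
by rewrite (inner_analytic_symbol Hf Bf MAf Hh) (inner_cohardy_hardy Hc HAf) addr0.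
Qed.

Lemma model_space_sum (F : nat -> T -> C) n : (forall i, model_space theta (F i)) ->
  model_space theta (fun z => \sum_(i < n) F i z).
Proof.
move=> MF; elim: n => [|n IH].
  have M0 := model_spaceZ 0 itheta (model_space_proj 0 itheta).
  have -> : (fun z => \sum_(i < 0) F i z) = fun z => 0 * model_proj theta 0 z.
    by apply/funext => z; rewrite big_ord0 mul0r.
  exact: M0.
by under eq_fun do rewrite big_ord_recr/=; exact: model_spaceD.
Qed.

(** The approximations are the projections onto K_theta of the Fourier partial
    sums of f; projecting onto a space that contains f brings them closer to f. *)
Lemma bounded_model_space_dense f : model_space theta f ->
  exists G : nat -> T -> C, [/\ forall n, model_space theta (G n),
    forall n, ae_bounded (G n) &
    nsq (fun z => f z - G n z) @[n --> \oo] --> 0].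
Proof.
move=> Mf; have /model_spaceP[Hf f0] := Mf; have Lf := hardy_L2 Hf.
have Htheta := inner_function_hardy itheta; have btheta := inner_function_bounded itheta.
pose c := fun n : nat => inner f (ez n).
pose G n z := \sum_(i < n) c i * model_proj theta i z.
have MG n : model_space theta (G n).
  apply: (@model_space_sum (fun i z => c i * model_proj theta i z) n) => i.
  exact: (model_spaceZ (c i) itheta (model_space_proj i itheta)).
exists G; split=> //.
  move=> n; apply: (@ae_bounded_sum _ n (fun i z => c i * model_proj theta i z)) => i.
  by apply: ae_boundedM; [exact: ae_bounded_cst|exact: ae_bounded_model_proj].
pose Q n z := \sum_(i < n) c i * toeplitz_poly theta i z.
have HQ n : hardy (Q n).
  elim: n => [|n IH].
    have H0 := hardyZ 0 (hardy_ez R 0).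
    have -> : Q 0%N = fun z => 0 * ez 0 z.
      by apply/funext => z; rewrite /Q big_ord0 mul0r.
    exact: H0.
  have -> : Q n.+1 = fun z => Q n z + c n * toeplitz_poly theta n z.
    by apply/funext => z; rewrite /Q big_ord_recr.
  exact: hardyD IH (hardyZ (c n) (hardy_tpoly _ _)).
have GE n z : G n z = tpoly c n z - theta z * Q n z.
  rewrite /G /Q /tpoly mulr_sumr -sumrB; apply: eq_bigr => i _.
  by rewrite /model_proj; ring.
apply: (@squeeze_cvgr _ _ _ _ (fun=> 0) (fun n => nsq (fun z => f z - tpoly c n z))).
- apply: nearW => n; rewrite nsq_ge0/=.
  have -> : (fun z => f z - tpoly c n z) =
      fun z => (f z - G n z) + (- 1) * (theta z * Q n z).
    by apply/funext => z; rewrite GE; ring.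
  have HtQ := hardyM Htheta btheta (HQ n); have LtQ := hardy_L2 HtQ.
  have /model_spaceP[HG G0] := MG n; have LG := hardy_L2 HG.
  have LB := L2B Lf LG; have LZ := L2Z (-1) LtQ.
  rewrite (nsqD_orth LB LZ) ?lerDl ?nsq_ge0//.
  by rewrite innerZr// innerBl// f0// G0// subrr mulr0.
- exact: cvg_cst.
- exact: hardy_approx.
Qed.

(** If M bounds A, the norm of A f = A (f - G n) is at most M times that of f
    - G n. *)
Lemma bounded_operator_eq0 (V W : (T -> C) -> Prop) (A : (T -> C) -> (T -> C)) f
    (G : nat -> T -> C) :
  (forall g, V g -> L2 g) -> (forall g, W g -> L2 g) ->
  (forall g h, V g -> V h -> V (fun z => -1 * g z + h z)) ->
  bounded_operator V W A -> V f -> (forall n, V (G n)) ->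
  (forall n, eq_ae (A (G n)) (cst 0)) ->
  nsq (fun z => f z - G n z) @[n --> \oo] --> 0 -> eq_ae (A f) (cst 0).
Proof.
move=> VL WL VB [AW Alin [M AM]] Vf VG AG0 Gf.
have LA g : V g -> L2 (A g) by move=> /AW /WL.
suff key n : nsq (A f) <= nsq (fun z => f z - G n z) * M ^+ 2.
  apply: (nsq_eq0 (LA _ Vf)); apply/eqP; rewrite eq_le nsq_ge0 andbT.
  have GM : nsq (fun z => f z - G n z) * M ^+ 2 @[n --> \oo] --> 0.
    by rewrite -[X in _ --> X](mul0r (M ^+ 2)); apply: cvgM => //; exact: cvg_cst.
  rewrite -(cvg_lim _ GM)//; apply: limr_ge; last exact: nearW.
  by apply/cvg_ex; eexists; exact: GM.
have Vd := VB _ _ (VG n) Vf.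
have e : eq_ae (A f) (A (fun z => -1 * G n z + f z)).
  have := Alin (-1) _ _ (VG n) Vf.
  by apply: filterS2 (AG0 n) => z -> ->; rewrite mulr0 add0r.
rewrite (eq_nsq (L2_cmeasurable (LA _ Vf)) (L2_cmeasurable (LA _ Vd)) e).
have -> : (fun z => f z - G n z) = fun z => -1 * G n z + f z.
  by apply/funext => z; rewrite mulN1r addrC.
have := AM _ Vd; rewrite !norm2E; [|exact: VL|exact: LA].
rewrite -EFinM lee_fin => le1.
rewrite -[leLHS]sqr_sqrtr ?nsq_ge0// -[X in _ <= X * _]sqr_sqrtr ?nsq_ge0// mulrC -exprMn.
by rewrite ler_pXn2r// nnegrE ?sqrtr_ge0// (le_trans (sqrtr_ge0 _) le1).
Qed.

End vanishing_operator.

Local Open Scope ring_scope.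
Local Open Scope complex_scope.

Theorem theorem4p4 (R : realType) (alpha theta phi : circle R -> R[i])
    (A : (circle R -> R[i]) -> (circle R -> R[i])) :
  inner_function alpha -> nonconstant alpha ->
  inner_function theta -> nonconstant theta ->
  inner_divides alpha theta ->
  L2 phi ->
  bounded_atto theta alpha phi A ->
  ((forall f, model_space theta f -> eq_ae (A f) (cst 0)) <->
   (exists h k : circle R -> R[i], [/\ H2 h, H2 k &
      eq_ae phi (fun z => alpha z * h z + (theta z * k z)^*)])).
Proof.
move=> ialpha nalpha itheta ntheta ad Lphi bA; split=> [A0|[h [k [Hh Hk e]]] f Mf].
  have [|h [k [Hh Hk e]]] := vanishing_form_symbol ialpha itheta ad nalpha ntheta Lphi.
    move=> f g Mf Bf Mg Bg; have /model_spaceP[Hf _] := Mf.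
    have /model_spaceP[Hg _] := Mg; have Lg := hardy_L2 Hg.
    have Lphif : L2 (fun z => (phi z * f z)%R).
      under eq_fun do rewrite mulrC.
      exact: L2M (L2_cmeasurable (hardy_L2 Hf)) Bf Lphi.
    have [MAf Af0] := bA.2 f Mf Lphif.
    have /model_spaceP[HAf _] := MAf; have LAf := hardy_L2 HAf.
    have := Af0 g Mg; rewrite innerBl// => /eqP; rewrite subr_eq0 => /eqP ->.
    by rewrite (eq_innerl LAf (L2_cst 0) Lg (A0 f Mf)) inner0l.
  by exists h, k; split=> //; exact/H2_hardy.
have [G [MG BG Gf]] := bounded_model_space_dense itheta Mf.
apply: (bounded_operator_eq0 _ _ _ bA.1 Mf MG _ Gf).
- by move=> g /model_spaceP[/hardy_L2].
- by move=> g /model_spaceP[/hardy_L2].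
- by move=> g l Mg Ml; apply: model_spaceD => //; exact: model_spaceZ.
- move=> n; apply: (atto_bounded_eq0 ialpha itheta Lphi bA _ _ e (MG n) (BG n));
    exact/H2_hardy.
Qed.
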